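(* Let $X$ be a compact metric space and $T:X\to X$ a surjective continuous map which is not one-to-one. Let $f\in C(X,\mathbb{R})$ and let $\mu$ be an ergodic $T$-invariant Borel probability measure with $h_{\mu}(T)>0$. Then for $\mu$-a.e. $x\in X$, $\lim_{\epsilon\to0}P_s(T,f,x,\epsilon)\geq P_{\mu}(T,f)$.
   Context: $W^s_{\epsilon}(x,T)=\{y\in X: d(T^nx,T^ny)\le\epsilon\ \forall n\ge0\}$. $f_n=\sum_{i=0}^{n-1}f\circ T^i$, $d_n(x,y)=\max_{0\le i<n}d(T^ix,T^iy)$, $P_n(T,f,\delta,K)=\sup\{\sum_{x\in E}\exp f_n(x): E\subseteq K,\ d_n(x,y)>\delta \text{ for distinct } x,y\in E\}$, and $P_s(T,f,x,\epsilon)=\lim_{\delta\to0}\limsup_{n\to\infty}\frac1n\log P_n(T,f,\delta,T^{-n}W^s_\epsilon(x,T))$, where $T^{-n}$ denotes the preimage. $P_\mu(T,f)=h_\mu(T)+\int f\,d\mu$. *)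

(* Defs.v *)
From HB Require Import structures.
From mathcomp Require Import all_boot all_order all_algebra.
From mathcomp Require Import all_classical all_reals all_analysis.
Set Implicit Arguments. Unset Strict Implicit. Unset Printing Implicit Defensive.
Import Order.TTheory GRing.Theory Num.Theory.
Import numFieldNormedType.Exports.
Local Open Scope classical_set_scope.
Local Open Scope ring_scope.

Section Defs.
Context {R : realType} {dsp : measure_display} {X : measurableType dsp}.
Variable (d : X -> X -> R).

Definition is_metric : Prop :=
  [/\ forall x y, 0 <= d x y,
      forall x y, d x y = 0 <-> x = y,
      forall x y, d x y = d y x &
      forall x y z, d x z <= d x y + d y z].

Definition dopen (U : set X) : Prop :=
  forall x, U x -> exists2 r : R, 0 < r & [set y | d x y < r] `<=` U.

Definition dcompact : Prop :=
  forall u : nat -> X, exists (phi : nat -> nat) (l : X),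
    (forall n m, (n < m)%N -> (phi n < phi m)%N) /\
    (fun n => d (u (phi n)) l) @ \oo --> (0 : R).

Definition borel_of_d : Prop := (@measurable _ X) = <<s dopen >>.

Definition dcontinuous (T : X -> X) : Prop :=
  forall x (e : R), 0 < e -> exists2 del : R, 0 < del &
    forall y, d x y < del -> d (T x) (T y) < e.

Definition dcontinuous_real (f : X -> R) : Prop :=
  forall x (e : R), 0 < e -> exists2 del : R, 0 < del &
    forall y, d x y < del -> `|f x - f y| < e.

Variable T : X -> X.

Definition Ws (eps : R) (x : X) : set X :=
  [set y | forall n : nat, d (iter n T x) (iter n T y) <= eps].

Definition dn (n : nat) (x y : X) : R :=
  \big[Order.max/0]_(i < n) d (iter i T x) (iter i T y).

Variable f : X -> R.

Definition fn (n : nat) (x : X) : R := \sum_(i < n) f (iter i T x).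

Definition separated (n : nat) (del : R) (K : set X) (E : seq X) : Prop :=
  [/\ uniq E, (forall x, x \in E -> K x) &
      forall x y, x \in E -> y \in E -> x != y -> del < dn n x y].

Definition Pn (n : nat) (del : R) (K : set X) : \bar R :=
  ereal_sup [set (\sum_(x <- E) expR (fn n x))%:E | E in separated n del K].

Definition Ps (x : X) (eps : R) : \bar R :=
  lim ((fun del : R =>
          limn_esup (fun n : nat =>
            ((n%:R)^-1)%:E * lne (Pn n del (iter n T @^-1` Ws eps x)))%E)
       @ 0^'+).

Definition lim_Ps (x : X) : \bar R := lim (Ps x @ 0^'+).

End Defs.

Section Entropy.
Context {R : realType} {dsp : measure_display} {X : measurableType dsp}.
Variable (mu : probability X R) (T : X -> X).

Definition T_invariant : Prop :=
  measurable_fun setT T /\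
  forall A, measurable A -> mu (T @^-1` A) = mu A.

Definition ergodic : Prop :=
  forall A, measurable A -> T @^-1` A = A -> mu A = 0%E \/ mu A = 1%E.

Definition eta_ent (t : R) : R := if t <= 0 then 0 else - (t * ln t).

Definition mpartition (k : nat) (P : 'I_k -> set X) : Prop :=
  [/\ forall i, measurable (P i),
      forall i j, i != j -> P i `&` P j = set0 &
      forall x, exists i, P i x].

(* atom of the join \/_{i<n} T^{-i} P indexed by the word w *)
Definition join_atom (k n : nat) (P : 'I_k -> set X) (w : {ffun 'I_n -> 'I_k})
  : set X := [set x | forall i : 'I_n, P (w i) (iter i T x)].

Definition Hjoin (k : nat) (P : 'I_k -> set X) (n : nat) : R :=
  \sum_(w : {ffun 'I_n -> 'I_k}) eta_ent (fine (mu (join_atom P w))).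

Definition h_part (k : nat) (P : 'I_k -> set X) : R :=
  limn (fun n : nat => Hjoin P n.+1 / n.+1%:R).

Definition h_mu : \bar R :=
  ereal_sup [set r | exists (k : nat) (P : 'I_k -> set X),
                       mpartition P /\ r = (h_part P)%:E].

Definition P_mu (f : X -> R) : \bar R :=
  (h_mu + \int[mu]_x (f x)%:E)%E.

End Entropy.

(* Main.v *)
(** Let Q be a finite measurable partition of diameter at most eps whose entropy
    h(T,Q) is close to the entropy of mu. Points with the same Q-itinerary of
    length N follow each other within eps for N steps, so T^-n of an N-cylinder C
    lies in T^-n W, where W is the N-step approximation of W^s_eps(x), x in C.
    The words A of length n seen inside T^-n C carry, on average over C, the
    conditional entropy H_(n+N) - H_N >= n h(T,Q); by Gibbs' inequality the
    average over C of the log of the sum over A of exp(sup f_n) is therefore at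
    least n (h(T,Q) + int f), and since it is at most n (log #Q + sup |f|), a set
    of C of measure bounded below, uniformly in n and N, nearly attains this
    value. Different words are turned into (n, delta)-separated points by
    replacing f with f - 2s 1_B: off a set B of small measure Q is locally
    constant at scale delta, and a greedy selection loses only a factor
    (1 + #Q e^-s)^n. Compactness replaces N by infinity. The set of x with
    infinitely many good n is mapped into itself by T, so by ergodicity it has
    full measure as soon as it has positive measure: no conditional measures and
    no pointwise ergodic theorem are needed. *)
Require Import Defs.
From HB Require Import structures.
From mathcomp Require Import all_boot all_order all_algebra.
From mathcomp Require Import all_classical all_reals all_analysis.
From mathcomp Require Import measurable_realfun.
From mathcomp Require Import ring lra zify.
Import Order.TTheory GRing.Theory Num.Theory.
Import numFieldNormedType.Exports.
Local Open Scope classical_set_scope.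
Local Open Scope ring_scope.

Set Implicit Arguments.
Unset Strict Implicit.
Unset Printing Implicit Defensive.

(** * Entropy inequalities for weights on finite sets *)

Section Gibbs.
Context {R : realType}.

Lemma eta_entE (t : R) : 0 <= t -> eta_ent t = - (t * ln t).
Proof.
rewrite /eta_ent le_eqVlt => /predU1P[<-|t0]; first by rewrite lexx mul0r oppr0.
by rewrite leNgt t0.
Qed.

(** This is [ln (1 + t) <= t] at [t = q / p - 1], multiplied by [p]. *)
Lemma gibbs1 (p q : R) : 0 <= p -> 0 <= q -> (0 < p -> 0 < q) ->
  p * ln q - p * ln p <= q - p.
Proof.
rewrite le_eqVlt => /predU1P[<- q0 _|p0 _ /(_ p0) q0].
  by rewrite !mul0r !subr0.
have : -1 < q / p - 1 by rewrite ltrBrDr addNr divr_gt0.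
move=> /le_ln1Dx; rewrite addrC subrK ln_div ?posrE// => h.
rewrite -mulrBr (le_trans (ler_wpM2l (ltW p0) h))//.
by rewrite mulrBr mulr1 mulrC divfK ?gt_eqF.
Qed.

(** The positivity condition on [q] shuts out the default value [ln 0 = 0], which would make a
    missing atom look harmless. *)
Lemma gibbs (I : finType) (p q : I -> R) :
  (forall i, 0 <= p i) -> (forall i, 0 <= q i) -> (forall i, 0 < p i -> 0 < q i) ->
  \sum_i q i <= \sum_i p i ->
  \sum_i p i * ln (q i) <= \sum_i p i * ln (p i).
Proof.
move=> p0 q0 pq spq; rewrite -subr_le0 -sumrB.
have : \sum_i (q i - p i) <= 0 by rewrite sumrB subr_le0.
by apply: le_trans; apply: ler_sum => i _; apply: gibbs1 => //; apply: pq.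
Qed.

(** Gibbs' inequality against the weights proportional to [expR (F i)] on the support of [p], scaled
    to the same mass [c]. Since [p] is not normalised, it applies directly to the restriction of a
    law to one cylinder; [eta_ent c] is the price of skipping the division by [c]. *)
Lemma gibbs_pressure (I : finType) (p F : I -> R) (c := \sum_i p i) :
  (forall i, 0 <= p i) -> 0 < c ->
  \sum_i eta_ent (p i) - eta_ent c + \sum_i p i * F i <=
    c * ln (\sum_(i | 0 < p i) expR (F i)).
Proof.
move=> p0 c0.
set Z := \sum_(i | 0 < p i) _.
have Z0 : 0 < Z.
  have [i pi0] : exists i, 0 < p i.
    apply/existsP; rewrite -[X in is_true X]negbK negb_exists.
    apply/negP => /forallP h.
    suff : c = 0 by move=> c00; rewrite c00 ltxx in c0.
    by apply: big1 => i _; apply/eqP; rewrite eq_le p0 andbT leNgt.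
  rewrite /Z (bigD1 i)//= ltr_wpDr ?expR_gt0//.
  by apply: sumr_ge0 => j _; exact: expR_ge0.
pose q i := if 0 < p i then c * expR (F i) / Z else 0.
have q0 i : 0 <= q i.
  rewrite /q; case: ifP => // _.
  by rewrite divr_ge0 ?mulr_ge0 ?expR_ge0 ?ltW.
have pq i : 0 < p i -> 0 < q i.
  by move=> pi0; rewrite /q pi0 divr_gt0 ?mulr_gt0 ?expR_gt0.
have sq : \sum_i q i <= \sum_i p i.
  rewrite -/c /q -big_mkcond/= -mulr_suml -mulr_sumr -/Z.
  by rewrite mulfK ?gt_eqF.
have := gibbs p0 q0 pq sq.
have -> : \sum_i p i * ln (q i) = c * ln c + \sum_i p i * F i - c * ln Z.
  rewrite /c !mulr_suml -big_split/= -sumrB; apply: eq_bigr => i _.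
  have [->|pi] := eqVneq (p i) 0; first by rewrite !mul0r addr0 subr0.
  have pi0 : 0 < p i by rewrite lt_neqAle eq_sym pi p0.
  rewrite /q pi0 ln_div ?posrE ?mulr_gt0 ?expR_gt0//.
  by rewrite lnM ?posrE ?expR_gt0// expRK mulrBr mulrDr.
rewrite (eta_entE (ltW c0)) opprK.
under [X in _ -> X + _ + _ <= _]eq_bigr do rewrite eta_entE//.
rewrite sumrN; lra.
Qed.

Section marginals.
Variables (I : finType) (p : I -> R).
Hypothesis p0 : forall i, 0 <= p i.

Definition marg (J : finType) (phi : I -> J) (j : J) : R :=
  \sum_(i | phi i == j) p i.

Lemma marg_ge0 (J : finType) (phi : I -> J) j : 0 <= marg phi j.
Proof. exact: sumr_ge0. Qed.

Lemma marg_ge (J : finType) (phi : I -> J) i : p i <= marg phi (phi i).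
Proof. by rewrite /marg (bigD1 i)//= lerDl sumr_ge0. Qed.

Lemma sum_marg (J : finType) (phi : I -> J) (h : J -> R) :
  \sum_j marg phi j * h j = \sum_i p i * h (phi i).
Proof.
rewrite [RHS](partition_big phi predT)//=; apply: eq_bigr => j _.
by rewrite /marg mulr_suml; apply: eq_bigr => i /eqP->.
Qed.

Lemma sum_marg1 (J : finType) (phi : I -> J) :
  \sum_j marg phi j = \sum_i p i.
Proof.
have := sum_marg phi (fun=> 1).
by under eq_bigr do rewrite mulr1; under [X in _ = X]eq_bigr do rewrite mulr1.
Qed.

Definition Hmarg (J : finType) (phi : I -> J) : R :=
  \sum_j eta_ent (marg phi j).

Lemma HmargE (J : finType) (phi : I -> J) :
  Hmarg phi = - \sum_i p i * ln (marg phi (phi i)).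
Proof.
rewrite -(sum_marg phi (fun j => ln (marg phi j))) -sumrN.
by apply: eq_bigr => j _; rewrite eta_entE// marg_ge0.
Qed.

(** A fibre of [phi] lies in a fibre of [psi \o phi], so the logarithm in [HmargE] can only grow
    under [psi]. *)
Lemma Hmarg_le (J K : finType) (phi : I -> J) (psi : J -> K) :
  Hmarg (psi \o phi) <= Hmarg phi.
Proof.
rewrite !HmargE lerN2; apply: ler_sum => i _.
have [->|pi] := eqVneq (p i) 0; first by rewrite !mul0r.
have pi0 : 0 < p i by rewrite lt_neqAle eq_sym pi p0.
have h1 : 0 < marg phi (phi i) by rewrite (lt_le_trans pi0)// marg_ge.
apply: ler_wpM2l => //=.
rewrite ler_ln ?posrE//.
  by rewrite /marg [leLHS]big_mkcond [leRHS]big_mkcond; apply: ler_sum => j _ /=;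
    case: eqP => [->|]; rewrite ?eqxx// => _; case: ifP.
by rewrite (lt_le_trans pi0)// -/((psi \o phi) i) marg_ge.
Qed.

End marginals.

(** Gibbs' inequality against [p(u,v) p(v,w) / p(v)], the weight with the same marginals that makes
    [u] and [w] independent given [v]. *)
Lemma Hmarg_ssub (U V W : finType) (p : (U * V * W)%type -> R) :
  (forall i, 0 <= p i) ->
  Hmarg p id + Hmarg p (fun x => x.1.2) <=
  Hmarg p (fun x => x.1) + Hmarg p (fun x => (x.1.2, x.2)).
Proof.
move=> p0; rewrite !(HmargE p0).
set puv := fun x : U * V * W => marg p (fun x => x.1) x.1.
set pvw := fun x : U * V * W => marg p (fun x => (x.1.2, x.2)) (x.1.2, x.2).
set pv := fun x : U * V * W => marg p (fun x => x.1.2) x.1.2.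
have pe i : marg p id i = p i.
  by rewrite /marg (eq_bigl (pred1 i)) ?big_pred1_eq.
pose q i := puv i * pvw i / pv i.
have q0 i : 0 <= q i by rewrite divr_ge0 ?mulr_ge0 ?marg_ge0.
have h1 i : 0 < p i -> 0 < puv i.
  by move=> /lt_le_trans; apply; apply: (marg_ge p0 (fun x => x.1) i).
have h2 i : 0 < p i -> 0 < pvw i.
  by move=> /lt_le_trans; apply; apply: (marg_ge p0 (fun x => (x.1.2,x.2)) i).
have h3 i : 0 < p i -> 0 < pv i.
  by move=> /lt_le_trans; apply; apply: (marg_ge p0 (fun x => x.1.2) i).
have pq i : 0 < p i -> 0 < q i.
  by move=> pi0; rewrite divr_gt0 ?mulr_gt0 ?h1 ?h2 ?h3.
have sq : \sum_i q i <= \sum_i p i.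
  have e1 v : \sum_u marg p (fun x => x.1) (u, v) = marg p (fun x => x.1.2) v.
    rewrite [RHS]/marg (partition_big (fun x : U * V * W => x.1.1) predT)//=.
    apply: eq_bigr => u _; apply: eq_bigl => -[[u' v'] w] /=.
    by rewrite xpair_eqE andbC.
  have e2 v : \sum_w marg p (fun x => (x.1.2, x.2)) (v, w) =
      marg p (fun x => x.1.2) v.
    by rewrite [RHS]/marg (partition_big (fun x : U * V * W => x.2) predT).
  rewrite -(sum_marg1 p (fun x => x.1.2)).
  have -> : \sum_i q i = \sum_v (\sum_u marg p (fun x => x.1) (u, v)) *
     (\sum_w marg p (fun x => (x.1.2, x.2)) (v, w)) / marg p (fun x => x.1.2) v.
    under [RHS]eq_bigr do rewrite -mulrA mulr_suml.
    rewrite exchange_big/= -(pair_big predT predT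
      (fun (a : U * V) w => q (a, w)))/=.
    rewrite -(pair_big predT predT (fun u v => \sum_w q (u, v, w)))/=.
    apply: eq_bigr => u _; apply: eq_bigr => v _.
    rewrite [X in _ * X]mulr_suml [RHS]mulr_sumr.
    by apply: eq_bigr => w _; rewrite mulrA.
  apply: ler_sum => v _; rewrite e1 e2.
  have [->|h] := eqVneq (marg p (fun x => x.1.2) v) 0; first by rewrite !mul0r.
  by rewrite mulfK.
have := gibbs p0 q0 pq sq.
have -> : \sum_i p i * ln (q i) = \sum_i p i * ln (puv i) +
   \sum_i p i * ln (pvw i) - \sum_i p i * ln (pv i).
  rewrite -big_split -sumrB/=; apply: eq_bigr => i _.
  have [->|pi] := eqVneq (p i) 0; first by rewrite !mul0r addr0 subr0.
  have pi0 : 0 < p i by rewrite lt_neqAle eq_sym pi p0.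
  by rewrite ln_div ?lnM ?posrE ?mulr_gt0 ?h1 ?h2 ?h3//; ring.
under [X in _ -> - X + _ <= _]eq_bigr do rewrite pe.
lra.
Qed.

End Gibbs.

(** * Laws and entropies of maps with finitely many values *)

Section FiniteValued.
Context {R : realType} {dsp : measure_display} {X : measurableType dsp}.
Variable mu : probability X R.

Definition prob (A : set X) : R := fine (mu A).

Lemma probE A : measurable A -> (prob A)%:E = mu A.
Proof. by move=> mA; rewrite /prob fineK// fin_num_measure. Qed.

Lemma prob_ge0 A : 0 <= prob A.
Proof. by rewrite /prob fine_ge0. Qed.

Lemma prob0 : prob set0 = 0.
Proof. by rewrite /prob measure0. Qed.

Lemma probT : prob setT = 1.
Proof. by rewrite /prob probability_setT. Qed.

Lemma le_prob A B : measurable A -> measurable B -> A `<=` B -> prob A <= prob B.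
Proof.
by move=> mA mB AB; rewrite -lee_fin !probE// le_measure ?inE.
Qed.

Lemma probability_inhabited : exists x : X, True.
Proof.
apply: contrapT => h; have := probability_setT mu.
have -> : [set: X] = set0 by rewrite -subset0 => x _; apply: h; exists x.
by rewrite measure0 => /eqP; rewrite eq_sym onee_eq0.
Qed.

Definition mfin (I : finType) (Z : X -> I) :=
  forall i, measurable (Z @^-1` [set i]).

Definition law (I : finType) (Z : X -> I) (i : I) : R := prob (Z @^-1` [set i]).

Lemma law_ge0 (I : finType) (Z : X -> I) i : 0 <= law Z i.
Proof. exact: prob_ge0. Qed.

Lemma prob_mem (I : finType) (Z : X -> I) (s : seq I) : mfin Z -> uniq s ->
  measurable [set x | Z x \in s] /\
  prob [set x | Z x \in s] = \sum_(i <- s) law Z i.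
Proof.
move=> mZ; elim: s => [_|i s ih /= /andP[si us]].
  have -> : [set x | Z x \in [::]] = set0 by rewrite -subset0 => x /=.
  by rewrite big_nil prob0; split.
have [ms ps] := ih us.
have e : [set x | Z x \in i :: s] = (Z @^-1` [set i]) `|` [set x | Z x \in s].
  apply/seteqP; split => x /=; rewrite inE.
    by case/orP => [/eqP|]; [left|right].
  by case=> [->|->]; rewrite ?eqxx// orbT.
have m : measurable [set x | Z x \in i :: s] by rewrite e; apply: measurableU.
split=> //; rewrite big_cons -ps; apply: EFin_inj.
rewrite EFinD /law !probE//; first by
  rewrite e measureU// -subset0 => x [/= ->]; rewrite (negbTE si).
Qed.

Lemma mfin_pred (I : finType) (Z : X -> I) (P : pred I) : mfin Z ->
  measurable [set x | P (Z x)].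
Proof.
move=> mZ; have [] := prob_mem mZ (enum_uniq P).
by under eq_set do rewrite mem_enum.
Qed.

Lemma prob_pred (I : finType) (Z : X -> I) (P : pred I) : mfin Z ->
  prob [set x | P (Z x)] = \sum_(i | P i) law Z i.
Proof.
move=> mZ; have [_] := prob_mem mZ (enum_uniq P).
by under eq_set do rewrite mem_enum; rewrite big_enum.
Qed.

Lemma sum_law (I : finType) (Z : X -> I) : mfin Z -> \sum_i law Z i = 1.
Proof.
move=> mZ; rewrite -probT -(prob_pred predT mZ); congr prob.
by apply/seteqP; split.
Qed.

Lemma mfin_comp (I J : finType) (Z : X -> I) (phi : I -> J) :
  mfin Z -> mfin (phi \o Z).
Proof.
move=> mZ j; have := mfin_pred (fun i => phi i == j) mZ.
by congr measurable; apply/seteqP; split => x /= /eqP.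
Qed.

Lemma law_comp (I J : finType) (Z : X -> I) (phi : I -> J) : mfin Z ->
  law (phi \o Z) = marg (law Z) phi.
Proof.
move=> mZ; apply/funext => j; rewrite /marg -prob_pred//; congr prob.
by apply/seteqP; split => x /= /eqP.
Qed.

Definition HZ (I : finType) (Z : X -> I) : R := \sum_i eta_ent (law Z i).

Lemma HZ_comp (I J : finType) (Z : X -> I) (phi : I -> J) : mfin Z ->
  HZ (phi \o Z) = Hmarg (law Z) phi.
Proof. by move=> mZ; rewrite /HZ law_comp. Qed.

Lemma HZ_le (I J : finType) (Z : X -> I) (Z' : X -> J) : mfin Z ->
  (forall x y, Z x = Z y -> Z' x = Z' y) -> HZ Z' <= HZ Z.
Proof.
move=> mZ h; have [x0 _] := probability_inhabited.
(* [phi] reads [Z'] at a chosen point of the fibre over [i]; the point [x0] only serves the empty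
   fibres. *)
pose phi i := Z' (xget x0 (Z @^-1` [set i])).
have -> : Z' = phi \o Z.
  apply/funext => x; apply: h => /=.
  by rewrite (@xgetPex _ x0 (Z @^-1` [set Z x]))//; exists x.
rewrite HZ_comp// -[leRHS]/(HZ (id \o Z)) HZ_comp//.
exact/(@Hmarg_le _ _ _ (law_ge0 Z) _ _ id phi).
Qed.

Lemma mfin_pair (I J : finType) (Z : X -> I) (Y : X -> J) :
  mfin Z -> mfin Y -> mfin (fun x => (Z x, Y x)).
Proof.
move=> mZ mY [i j].
rewrite (_ : _ @^-1` _ = (Z @^-1` [set i]) `&` (Y @^-1` [set j])).
  exact: measurableI.
by apply/seteqP; split => x /= [-> ->].
Qed.

(** Strong subadditivity: conditioning on more lowers the entropy of what remains. *)
Lemma HZ_ssub (U V W : finType) (Z : X -> U) (Y : X -> V) (Y' : X -> W) :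
  mfin Z -> mfin Y -> mfin Y' ->
  HZ (fun x => (Z x, Y x, Y' x)) + HZ Y <=
  HZ (fun x => (Z x, Y x)) + HZ (fun x => (Y x, Y' x)).
Proof.
move=> mZ mY mY'; pose P x := (Z x, Y x, Y' x).
have mP : mfin P by apply: mfin_pair => //; apply: mfin_pair.
have := Hmarg_ssub (law_ge0 P); rewrite -!HZ_comp//.
Qed.

End FiniteValued.

(** * Itineraries under [T] and the entropy of a labelling *)

Section Words.
Context {R : realType} {dsp : measure_display} {X : measurableType dsp}.
Variables (mu : probability X R) (T : X -> X).
Hypothesis invT : T_invariant mu T.

Lemma measurable_iter n : measurable_fun setT (iter n T).
Proof.
elim: n => [|n ih]; first exact: measurable_id.
exact: (measurableT_comp invT.1 ih).
Qed.

Lemma measurable_preim n A : measurable A -> measurable (iter n T @^-1` A).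
Proof.
by move=> mA; rewrite -[X in measurable X]setTI; apply: measurable_iter.
Qed.

Lemma measure_preim n A : measurable A -> mu (iter n T @^-1` A) = mu A.
Proof.
move=> mA; elim: n => [//|n ih].
rewrite -ih -(invT.2 (iter n T @^-1` A)); last exact: measurable_preim.
by congr (mu _); apply/seteqP; split => x /=; rewrite -iterS iterSr.
Qed.

Lemma mfin_iter (I : finType) (Z : X -> I) n : mfin Z -> mfin (Z \o iter n T).
Proof. by move=> mZ i; rewrite comp_preimage; apply: measurable_preim. Qed.

Lemma law_iter (I : finType) (Z : X -> I) n : mfin Z ->
  law mu (Z \o iter n T) = law mu Z.
Proof.
by move=> mZ; apply/funext => i; rewrite /law /prob comp_preimage measure_preim.
Qed.

Section label.
Variables (k : nat) (q : X -> 'I_k).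
Hypothesis mq : mfin q.

Definition word n (x : X) : {ffun 'I_n -> 'I_k} := [ffun i : 'I_n => q (iter i T x)].

Lemma wordP n x y :
  (forall i, (i < n)%N -> q (iter i T x) = q (iter i T y)) <->
  word n x = word n y.
Proof.
split=> [h|/ffunP h i ilt].
  by apply/ffunP => i; rewrite !ffunE h.
by have := h (Ordinal ilt); rewrite !ffunE.
Qed.

Lemma mfin_word n : mfin (word n).
Proof.
move=> w.
rewrite (_ : _ @^-1` _ =
  \bigcap_(i in [set: 'I_n]) ((q \o iter i T) @^-1` [set w i])).
  apply: fin_bigcap_measurable; first exact: finite_finset.
  by move=> i _; apply: mfin_iter.
apply/seteqP; split => x /=.
  by move=> <- i _ /=; rewrite ffunE.
by move=> h; apply/ffunP => i; rewrite ffunE; apply: h.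
Qed.

Arguments mfin_word : clear implicits.

Definition Hw n : R := HZ mu (word n).

(** Strong subadditivity for the letter at time 0, the word at times 1 to [n] and the letter at time
    [n.+1]. By invariance of [mu] a word has the same law wherever it is read, so both overlapping
    blocks have entropy at most [Hw n.+1]. *)
Lemma Hw_diff n : Hw n.+2 - Hw n.+1 <= Hw n.+1 - Hw n.
Proof.
have m1 := mfin_iter 1 (mfin_word n).
have := HZ_ssub mu mq m1 (mfin_iter n.+1 mq).
have e1 : HZ mu (word n \o iter 1 T) = Hw n by rewrite /HZ law_iter//; exact: mfin_word.
have e2 : HZ mu (fun x => (q x, (word n \o iter 1 T) x)) <= Hw n.+1.
  apply: HZ_le; first exact: mfin_word.
  move=> x y /wordP h; congr pair; first exact: (h 0%N).
  by apply/wordP => i ilt; rewrite /= -!iterSr h.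
have e3 : HZ mu (fun x => ((word n \o iter 1 T) x, (q \o iter n.+1 T) x)) <= Hw n.+1.
  have -> : Hw n.+1 = HZ mu (word n.+1 \o iter 1 T).
    by rewrite /Hw /HZ law_iter//; exact: mfin_word.
  apply: HZ_le; first by apply: mfin_iter; exact: mfin_word.
  move=> x y /wordP h; congr pair.
    by apply/wordP => i ilt; apply: h; lia.
  by have := h n (ltnSn n); rewrite /= -!iterS !iterSr.
have e4 : Hw n.+2 <= HZ mu (fun x => (q x, (word n \o iter 1 T) x, (q \o iter n.+1 T) x)).
  apply: HZ_le.
    by apply: mfin_pair; [apply: mfin_pair => //|apply: mfin_iter].
  move=> x y [h0 /wordP h1 h2]; apply/wordP => -[//|i].
  rewrite !ltnS leq_eqVlt => /predU1P[-> //|ilt].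
  by rewrite !iterSr; apply: h1.
move: e1 e2 e3 e4; lra.
Qed.

Lemma Hw_ge0_diff n : 0 <= Hw n.+1 - Hw n.
Proof.
rewrite subr_ge0; apply: HZ_le; first exact: mfin_word.
by move=> x y /wordP h; apply/wordP => i ilt; apply: h; lia.
Qed.

Lemma Hw0 : Hw 0 = 0.
Proof.
rewrite /Hw /HZ big1// => w _.
have -> : law mu (word 0) w = 1.
  rewrite /law -(probT mu); congr prob; apply/seteqP; split => x // _ /=.
  by apply/ffunP => -[].
by rewrite eta_entE// ln1 mulr0 oppr0.
Qed.

(** The limit is taken over increments, which decrease, and not over means: [hw] is then a lower
    bound for each increment. [h_partE] identifies it with the entropy of the partition. *)
Definition hw : R := limn (fun n => Hw n.+1 - Hw n).

Let Hw_diff_homo : {homo (fun n => Hw n.+1 - Hw n) : n m / (n <= m)%N >-> m <= n}.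
Proof.
by apply/nonincreasing_seqP => n; apply: Hw_diff.
Qed.

Let Hw_diff_cvg : cvgn (fun n => Hw n.+1 - Hw n).
Proof.
apply: nonincreasing_is_cvgn; first exact: Hw_diff_homo.
by exists 0 => _ [n _ <-]; apply: Hw_ge0_diff.
Qed.

Lemma hw_le_diff n : hw <= Hw n.+1 - Hw n.
Proof. exact: (nonincreasing_cvgn_ge Hw_diff_homo Hw_diff_cvg). Qed.

(** Sum of [n] increments starting at [N]. The bound does not depend on [N], which is what later
    allows the horizon to tend to infinity. *)
Lemma hw_le n N : n%:R * hw <= Hw (n + N) - Hw N.
Proof.
elim: n => [|n ih]; first by rewrite mul0r add0n subrr.
have := hw_le_diff (n + N); rewrite addSn -[n.+1]addn1 natrD mulrDl mul1r.
move: ih; lra.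
Qed.

(** The increments telescope from [Hw 0 = 0], so the left side is their Cesàro mean. *)
Lemma cvg_Hw_mean : (fun n => Hw n.+1 / n.+1%:R) @ \oo --> hw.
Proof.
suff -> : (fun n => Hw n.+1 / n.+1%:R) =
    arithmetic_mean (fun n => Hw n.+1 - Hw n) by exact: cesaro.
apply/funext => n; rewrite /arithmetic_mean/= mulrC; congr (_ * _).
have := telescopeK Hw; rewrite /telescope => ->/=.
by rewrite Hw0 subr0.
Qed.

Lemma h_partE (P : 'I_k -> set X) : (forall i, P i = q @^-1` [set i]) ->
  h_part mu T P = hw.
Proof.
move=> Pq; rewrite /h_part -(cvg_lim _ cvg_Hw_mean)//.
congr (lim (_ @ \oo)); apply/funext => n; congr (_ / _).
apply: eq_bigr => w _; congr (eta_ent (prob mu _)).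
apply/seteqP; split => x /=.
  by move=> h; apply/ffunP => i; rewrite ffunE; have := h i; rewrite Pq.
by move=> <- i; rewrite Pq /= ffunE.
Qed.

End label.
Arguments mfin_word [k q] mq n.

Lemma hw_le_refine k l (p : X -> 'I_k) (q : X -> 'I_l) : mfin p -> mfin q ->
  (forall x y, q x = q y -> p x = p y) -> hw p <= hw q.
Proof.
move=> mp mq h.
apply: ler_cvg_to (cvg_Hw_mean mp) (cvg_Hw_mean mq) _.
apply: nearW => n; rewrite ler_pM2r ?invr_gt0//.
apply: HZ_le; first exact: mfin_word.
by move=> x y /wordP h'; apply/wordP => i ilt; apply: h; apply: h'.
Qed.

End Words.
Arguments mfin_word {R dsp X mu T} invT {k q} mq n.

Lemma mpartition_label {dsp} {X : measurableType dsp} k (P : 'I_k -> set X) :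
  mpartition P -> exists2 q : X -> 'I_k, mfin q & forall i, P i = q @^-1` [set i].
Proof.
move=> [mP dP cP]; pose q x := sval (cid (cP x)).
have qP x : P (q x) x by rewrite /q; case: cid.
have Pq i : P i = q @^-1` [set i].
  apply/seteqP; split => x /=; last by move=> <-.
  move=> Px; apply/eqP; apply: contrapT => /negP h.
  by have := dP _ _ h; rewrite -subset0 => /(_ x); apply.
by exists q => // i; rewrite -Pq.
Qed.

(** * Sequential compactness and continuity for [d] *)

Section Metric.
Context {R : realType} {dsp : measure_display} {X : measurableType dsp}.
Variable d : X -> X -> R.
Hypothesis md : is_metric d.

Let d_ge0 x y : 0 <= d x y. Proof. by case: md. Qed.
Let dxx x : d x x = 0. Proof. by case: md => _ h _ _; apply/h. Qed.
Let dC x y : d x y = d y x. Proof. by case: md. Qed.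
Let d_tri x y z : d x z <= d x y + d y z. Proof. by case: md. Qed.

Definition dcvg (u : nat -> X) (l : X) := (fun n => d (u n) l) @ \oo --> (0 : R).

Lemma dcvgP u l : dcvg u l <->
  forall e, 0 < e -> exists N, forall n, (N <= n)%N -> d (u n) l < e.
Proof.
split=> [/cvgrPdist_lt h e e0|h].
  have [N _ hN] := h _ e0; exists N => n Nn.
  by have := hN n Nn; rewrite /= sub0r normrN ger0_norm.
apply/cvgrPdist_lt => e e0; have [N hN] := h _ e0.
by exists N => // n Nn; rewrite /= sub0r normrN ger0_norm// hN.
Qed.

Lemma dcvg_sub u l (phi : nat -> nat) :
  (forall n m, (n < m)%N -> (phi n < phi m)%N) -> dcvg u l -> dcvg (u \o phi) l.
Proof.
move=> hphi /dcvgP h; apply/dcvgP => e /h[N hN]; exists N => n Nn.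
apply: hN; apply: leq_trans Nn _.
elim: n => // n ih; exact: leq_ltn_trans ih (hphi _ _ (ltnSn n)).
Qed.

Lemma dcvg_cst x : dcvg (fun=> x) x.
Proof. by apply/dcvgP => e e0; exists 0%N => n _; rewrite dxx. Qed.

Lemma dcvg_map (T : X -> X) u l : dcontinuous d T -> dcvg u l -> dcvg (T \o u) (T l).
Proof.
move=> cT /dcvgP h; apply/dcvgP => e e0; have [del del0 hdel] := cT l e e0.
have [N hN] := h _ del0; exists N => n Nn /=.
by rewrite dC hdel// dC hN.
Qed.

Lemma dcvg_iter (T : X -> X) i u l : dcontinuous d T -> dcvg u l ->
  dcvg (fun n => iter i T (u n)) (iter i T l).
Proof.
by move=> cT ul; elim: i => // i ih; exact: (dcvg_map cT ih).
Qed.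

Lemma dcvg_fun (f : X -> R) u l : dcontinuous_real d f -> dcvg u l ->
  f (u n) @[n --> \oo] --> f l.
Proof.
move=> cf /dcvgP h; apply/cvgrPdist_lt => e e0; have [del del0 hdel] := cf l e e0.
have [N hN] := h _ del0; exists N => // n Nn /=.
by rewrite hdel// dC hN.
Qed.

Lemma dcvg_dist u v l m : dcvg u l -> dcvg v m ->
  d (u n) (v n) @[n --> \oo] --> d l m.
Proof.
move=> /dcvgP hu /dcvgP hv; apply/cvgrPdist_lt => e e0.
have e20 : 0 < e / 2 by rewrite divr_gt0.
have [N hN] := hu _ e20; have [M hM] := hv _ e20.
exists (maxn N M) => // n /=; rewrite geq_max => /andP[/hN h1 /hM h2].
have := d_tri l (u n) m; have := d_tri (u n) (v n) m.
have := d_tri (u n) l (v n); have := d_tri l m (v n).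
rewrite (dC l (u n)) (dC m (v n)) ltr_norml; lra.
Qed.

Definition dclosed (A : set X) := dopen d (~` A).

Lemma dclosedP A : dclosed A <-> forall u l, (forall n, A (u n)) -> dcvg u l -> A l.
Proof.
split=> [oA u l uA /dcvgP ul|h].
  apply: contrapT => /oA[r r0 hr]; have [N hN] := ul r r0.
  by apply: (hr (u N)) (uA N) => /=; rewrite dC hN.
move=> x nAx; apply: contrapT => hx.
have /choice[u hu] n : exists y, A y /\ d x y < n.+1%:R^-1.
  apply: contrapT => hn; apply: hx; exists n.+1%:R^-1; first by rewrite invr_gt0.
  by move=> y /= dxy Ay; apply: hn; exists y.
apply: nAx; apply: (h u) => [n|]; first by case: (hu n).
apply/dcvgP => e e0; have [N _ hN] := near_infty_natSinv_lt (PosNum e0).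
exists N => n Nn; rewrite dC; apply: lt_trans (hu n).2 _.
exact: hN.
Qed.

(** Extract once more for each entry of [s]; convergence already obtained survives by [dcvg_sub]. *)
Lemma dcompact_seq (I : eqType) (s : seq I) (u : nat -> I -> X) : dcompact d ->
  exists phi : nat -> nat, exists l : I -> X,
    (forall n m, (n < m)%N -> (phi n < phi m)%N) /\
    (forall i, i \in s -> dcvg (fun n => u (phi n) i) (l i)).
Proof.
move=> cd; elim: s => [|i s [phi [l [hphi hl]]]].
  by exists id, (u 0%N).
have [psi [m [hpsi hm]]] := cd (fun n => u (phi n) i).
exists (phi \o psi), (fun j => if j == i then m else l j); split.
  by move=> a b ab; apply: hphi; apply: hpsi.
move=> j; rewrite inE; case: eqP => [-> _ //|_ /= js].
exact: (dcvg_sub hpsi (hl j js)).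
Qed.

Lemma dopen_ball x r : dopen d [set y | d x y < r].
Proof.
move=> y /= dxy; exists (r - d x y); first by rewrite subr_gt0.
by move=> z /= yz; have := d_tri x y z; lra.
Qed.

Lemma dopen_setT : dopen d setT.
Proof. by move=> x _; exists 1. Qed.

Lemma dopen_bigcup (I : Type) (F : I -> set X) : (forall i, dopen d (F i)) ->
  dopen d (\bigcup_i F i).
Proof.
move=> oF x [i _ /oF[r r0 h]]; exists r => // y yr; exists i => //; exact: h.
Qed.

Lemma dopenI A B : dopen d A -> dopen d B -> dopen d (A `&` B).
Proof.
move=> oA oB x [/oA[r r0 hr] /oB[s s0 hs]].
exists (Num.min r s); first by rewrite lt_min r0.
by move=> y /=; rewrite lt_min => /andP[yr ys]; split; [apply: hr|apply: hs].
Qed.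

Lemma dclosedU A B : dclosed A -> dclosed B -> dclosed (A `|` B).
Proof. by rewrite /dclosed setCU; exact: dopenI. Qed.

Lemma dclosed0 : dclosed set0.
Proof. by rewrite /dclosed setC0; exact: dopen_setT. Qed.

Lemma dcover (e : R) : dcompact d -> 0 < e ->
  exists s : seq X, forall x, exists2 y, y \in s & d y x < e.
Proof.
move=> cd e0; apply: contrapT => hs.
have /choice[g hg] : forall s : seq X, exists x, forall y, y \in s -> e <= d y x.
  move=> s; apply: contrapT => h; apply: hs; exists s => x.
  apply: contrapT => hx; apply: h; exists x => y ys.
  by rewrite leNgt; apply/negP => dyx; apply: hx; exists y.
(* [v n] lists the first [n] points of a sequence whose terms are pairwise at distance at least [e];
   it has no convergent subsequence. *)
pose fix v n : seq X := if n is n'.+1 then g (v n') :: v n' else [::].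
pose u n := g (v n).
have uv n m : (n < m)%N -> u n \in v m.
  elim: m => // m ih; rewrite ltnS leq_eqVlt => /predU1P[->|/ih h] /=.
    by rewrite inE eqxx.
  by rewrite inE h orbT.
have [phi [l [hphi /dcvgP hl]]] := cd u.
have [N hN] := hl (e / 2) (divr_gt0 e0 (ltr0Sn _ _)).
have := hg _ _ (uv _ _ (hphi N N.+1 (ltnSn N))); rewrite -/(u _).
have := hN N (leqnn N); have := hN N.+1 (leqnSn N) => /=.
have := d_tri (u (phi N)) l (u (phi N.+1)); rewrite (dC l); lra.
Qed.

Lemma dbounded (f : X -> R) : dcompact d -> dcontinuous_real d f ->
  exists M, forall x, `|f x| <= M.
Proof.
move=> cd cf; apply: contrapT => h.
have /choice[u hu] : forall n : nat, exists x, n%:R < `|f x|.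
  move=> n; apply: contrapT => hn; apply: h; exists n%:R => x.
  by rewrite leNgt; apply/negP => hx; apply: hn; exists x.
have [phi [l [hphi hl]]] := cd u.
have /cvgrPdist_lt/(_ 1 ltr01)[N _ hN] := dcvg_fun cf hl.
have phige n : (n <= phi n)%N.
  by elim: n => // n ih; exact: leq_ltn_trans ih (hphi _ _ (ltnSn n)).
pose m := maxn N (Num.truncn (`|f l| + 1)).+1.
have := hN m (leq_maxl _ _) => /= h1; have h2 := hu (phi m).
have : (`|f l| + 1) < m%:R.
  by apply: lt_le_trans (truncnS_gt _) _; rewrite ler_nat leq_maxr.
have : m%:R <= (phi m)%:R :> R by rewrite ler_nat.
have := ler_normB (f l) (f l - f (u (phi m))); rewrite opprB addrCA subrr addr0.
by move: h1 h2 => /=; lra.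
Qed.

End Metric.

(** * Regularity of [mu], and labels adapted to the metric *)

Section Borel.
Context {R : realType} {dsp : measure_display} {X : measurableType dsp}.
Variables (d : X -> X -> R) (mu : probability X R).
Hypotheses (md : is_metric d) (bd : borel_of_d d).

Lemma dopen_measurable A : dopen d A -> measurable A.
Proof. by move=> oA; rewrite bd; apply: sub_sigma_algebra. Qed.

Lemma dclosed_measurable A : dclosed d A -> measurable A.
Proof. by move=> /dopen_measurable mA; rewrite -(setCK A); apply: measurableC. Qed.

Lemma prob_nonincreasing_cvg0 (F : nat -> set X) e : (forall n, measurable (F n)) ->
  (forall n m, (n <= m)%N -> F m `<=` F n) -> \bigcap_n F n = set0 -> 0 < e ->
  exists n, prob mu (F n) < e.
Proof.
move=> mF dF F0 e0.
have : mu (F n) @[n --> \oo] --> mu (\bigcap_n F n).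
  apply: nonincreasing_cvg_mu => //.
  - by rewrite (le_lt_trans (probability_le1 mu (mF 0%N))) ?ltry.
  - exact: bigcapT_measurable.
  - by move=> n m nm; apply/subsetPset; apply: dF.
rewrite F0 measure0 => /fine_cvg /= /cvgrPdist_lt/(_ _ e0)[N _ hN].
exists N; have := hN N (leqnn N).
by rewrite /= sub0r normrN ger0_norm// fine_ge0.
Qed.

(** Approximation is required from both sides so that the class is stable under complement, where
    [K] and [U] exchange roles. *)
Definition regular_set (A : set X) := forall e, 0 < e ->
  exists K U, [/\ dclosed d K, dopen d U, K `<=` A, A `<=` U & prob mu (U `\` K) < e].

(** An open set is the increasing union of the closed sets of points whose ball of radius
    [n.+1%:R^-1] stays inside it. *)
Lemma regular_set_dopen A : dopen d A -> regular_set A.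
Proof.
move=> oA e e0.
pose K n := [set y | forall z, d y z < n.+1%:R^-1 -> A z].
have cK n : dclosed d (K n).
  move=> y /= /existsNP[z /not_implyP[yz nAz]].
  exists (n.+1%:R^-1 - d y z); first by rewrite subr_gt0.
  move=> w /= yw h; apply/nAz/h; case: md => _ _ dC d_tri.
  by rewrite (le_lt_trans (d_tri w y z))// -ltrBrDr dC.
have KA n : K n `<=` A.
  by move=> y; apply; case: md => _ h _ _; rewrite (h y y).2// invr_gt0.
have [n hn] : exists n, prob mu (A `\` K n) < e.
  apply: prob_nonincreasing_cvg0 => //.
  - by move=> n; apply: measurableD; [exact: dopen_measurable|exact: dclosed_measurable].
  - move=> n m nm y [Ay nK]; split => // h; apply: nK => z yz; apply: h.
    by apply: lt_le_trans yz _; rewrite lef_pV2 ?posrE// ler_nat ltnS.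
  - rewrite -subset0 => y h; have [Ay _] := h 0%N I.
    have [r r0 hr] := oA _ Ay; have [N _ hN] := near_infty_natSinv_lt (PosNum r0).
    have [_] := h N I; apply => z yz; apply: hr => /=; apply: lt_trans yz _.
    exact: (hN N (leqnn N)).
by exists (K n), A; split.
Qed.

Lemma regular_setC A : regular_set A -> regular_set (~` A).
Proof.
move=> rA e /rA[K [U [cK oU KA AU h]]]; exists (~` U), (~` K); split => //.
- by rewrite /dclosed setCK.
- exact: subsetC.
- exact: subsetC.
- by rewrite setDE setCK setIC -setDE.
Qed.

(** All the open sets may be united, but only finitely many closed ones. Half of [e] is spread
    geometrically over the gaps [U n] minus [K n], the other half pays for the closed sets left
    out. *)
Lemma regular_set_bigcup (F : nat -> set X) : (forall n, regular_set (F n)) ->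
  regular_set (\bigcup_n F n).
Proof.
move=> rF e e0.
have e20 : 0 < e / 2 by rewrite divr_gt0.
have /choice[K /choice[U hKU]] n : exists K U, [/\ dclosed d K, dopen d U, K `<=` F n,
    F n `<=` U & prob mu (U `\` K) < (e / 2) / (2 ^ n.+1)%:R].
  by apply: rF; rewrite divr_gt0// ltr0n expn_gt0.
pose KK n := \bigcup_(i in `I_n) K i.
have cKK n : dclosed d (KK n).
  rewrite /KK bigcup_mkord.
  elim: n => [|n ih]; first by rewrite big_ord0; exact: dclosed0.
  by rewrite big_ord_recr/=; apply: dclosedU => //; case: (hKU n).
have mU n : measurable (U n) by apply: dopen_measurable; case: (hKU n).
have mK n : measurable (K n) by apply: dclosed_measurable; case: (hKU n).
have mUU : measurable (\bigcup_n U n) by exact: bigcupT_measurable.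
have mKK : measurable (\bigcup_n K n) by exact: bigcupT_measurable.
have [N hN] : exists N, prob mu (\bigcup_n K n `\` KK N) < e / 2.
  apply: prob_nonincreasing_cvg0 => //.
  - by move=> n; apply: measurableD => //; exact: dclosed_measurable.
  - move=> n m nm x [Kx nKx]; split => // -[i /= im Kix]; apply: nKx.
    by exists i => //=; apply: leq_trans im nm.
  - rewrite -subset0 => x h; have [[i _ Kix] _] := h 0%N I.
    by have [_] := h i.+1 I; apply; exists i => /=.
exists (KK N), (\bigcup_n U n); split => //.
- by apply: dopen_bigcup => n; case: (hKU n).
- by move=> x [i _ Kix]; exists i => //; case: (hKU i) => _ _ h _ _; apply: h.
- by move=> x [i _ Kix]; exists i => //; case: (hKU i) => _ _ _ h _; apply: h.
rewrite -lte_fin probE; last first.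
  by apply: measurableD => //; exact: dclosed_measurable.
have sub : \bigcup_n U n `\` KK N `<=`
    (\bigcup_n (U n `\` K n)) `|` (\bigcup_n K n `\` KK N).
  move=> x [[i _ Ux] nK]; have [Kx|nKx] := pselect (K i x).
    by right; split => //; exists i.
  by left; exists i.
have m1 : measurable (\bigcup_n (U n `\` K n)).
  by apply: bigcupT_measurable => n; apply: measurableD.
have m2 : measurable (\bigcup_n K n `\` KK N).
  by apply: measurableD => //; exact: dclosed_measurable.
apply: (@le_lt_trans _ _ (mu ((\bigcup_n (U n `\` K n)) `|` (\bigcup_n K n `\` KK N)))).
  rewrite le_measure ?inE//; last exact: measurableU.
  by apply: measurableD => //; exact: dclosed_measurable.
apply: (le_lt_trans (measureU2 _ _ _)) => //.
rewrite (splitr e) EFinD lee_ltD//; first exact: fin_num_measure.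
  apply: (le_trans (measure_sigma_subadditive _ _ _ (@subset_refl _ _))) => //.
    by move=> n; apply: measurableD.
  have := @epsilon_trick R (fun=> 0%E) (e / 2) xpredT (fun=> lexx _) (ltW e20).
  rewrite [X in (_ <= X + _)%E]eseries0// add0e; apply: le_trans.
  apply: lee_nneseries => // n _; rewrite add0e.
  have [_ _ _ _ /ltW] := hKU n.
  by rewrite -lee_fin probE//; exact: measurableD.
by move: hN; rewrite -lte_fin probE.
Qed.

Lemma regular_set_measurable A : measurable A -> regular_set A.
Proof.
rewrite bd; apply: smallest_sub; last exact: regular_set_dopen.
split.
- by apply: regular_set_dopen => x.
- by move=> A' rA; rewrite setTD; exact: regular_setC.
- exact: regular_set_bigcup.
Qed.

Lemma inner_regular A e : measurable A -> 0 < e ->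
  exists K, [/\ dclosed d K, K `<=` A & prob mu (A `\` K) < e].
Proof.
move=> mA e0; have [K [U [cK oU KA AU h]]] := regular_set_measurable mA e0.
exists K; split=> //; apply: le_lt_trans h.
have mK := dclosed_measurable cK; have mU := dopen_measurable oU.
by apply: le_prob; [exact: measurableD|exact: measurableD|move=> x [/AU]].
Qed.

Lemma prob_le_bigsetU (I : Type) (s : seq I) (F : I -> set X) :
  (forall i, measurable (F i)) ->
  prob mu (\big[setU/set0]_(i <- s) F i) <= \sum_(i <- s) prob mu (F i).
Proof.
move=> mF; have mB t : measurable (\big[setU/set0]_(i <- t) F i).
  by apply: bigsetU_measurable.
elim: s => [|i s ih]; first by rewrite !big_nil prob0.
rewrite big_cons [leRHS]big_cons -lee_fin EFinD !probE//; last exact: measurableU.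
rewrite (le_trans (measureU2 _ _ _))//; apply: leeD => //.
by move: ih; rewrite -lee_fin probE.
Qed.

(* A label is locally constant off a small set: replace each cell by a closed
   subset of almost full measure. *)
Lemma label_near_constant (k : nat) (q : X -> 'I_k) e : dcompact d -> mfin q -> 0 < e ->
  exists B del, [/\ measurable B, prob mu B <= e, 0 < del &
    forall x y, ~ B x -> ~ B y -> d x y <= del -> q x = q y].
Proof.
move=> cd mq e0.
have ek : 0 < e / k.+1%:R by rewrite divr_gt0.
have /choice[K hK] i : exists K, [/\ dclosed d K, K `<=` q @^-1` [set i] &
    prob mu (q @^-1` [set i] `\` K) < e / k.+1%:R].
  exact: inner_regular.
have mK i : measurable (K i) by apply: dclosed_measurable; case: (hK i).
pose F i := q @^-1` [set i] `\` K i.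
have mF i : measurable (F i) by apply: measurableD.
pose B := \big[setU/set0]_(i <- enum 'I_k) F i.
have BP x : ~ B x -> K (q x) x.
  move=> nB; apply: contrapT => nK; apply: nB.
  by rewrite /B -bigcup_seq; exists (q x) => //=; rewrite mem_enum.
have cU (s : seq 'I_k) : dclosed d (\big[setU/set0]_(i <- s) K i).
  elim: s => [|i s ih]; first by rewrite big_nil; exact: dclosed0.
  by rewrite big_cons; apply: dclosedU => //; case: (hK i).
suff [del del0 hdel] : exists2 del, 0 < del &
    forall x y, ~ B x -> ~ B y -> d x y <= del -> q x = q y.
  exists B, del; split => //; first exact: bigsetU_measurable.
  apply: (le_trans (prob_le_bigsetU _ mF)).
  apply: (@le_trans _ _ (\sum_(i <- enum 'I_k) (e / k.+1%:R))).
    by apply: ler_sum => i _; apply: ltW; case: (hK i).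
  rewrite big_const_seq count_predT size_enum_ord iter_addr_0 -[leLHS]mulr_natr.
  by rewrite mulrAC ler_pdivrMr// ler_pM2l// ler_nat.
apply: contrapT => hn.
have /choice[u hu] n : exists xy : X * X, [/\ ~ B xy.1, ~ B xy.2,
    d xy.1 xy.2 <= n.+1%:R^-1 & q xy.1 <> q xy.2].
  apply: contrapT => hx; apply: hn; exists n.+1%:R^-1; first by rewrite invr_gt0.
  move=> x y Bx By xy; apply: contrapT => qxy; apply: hx; exists (x, y); split => //.
have [phi [l [hphi hl]]] := cd (fun n => (u n).1).
have [j Kjl] : exists j, K j l.
  have : (\big[setU/set0]_(i <- enum 'I_k) K i) l.
    apply: ((dclosedP md _).1 (cU (enum 'I_k)) _ _ _ hl) => n.
    rewrite -bigcup_seq; exists (q (u (phi n)).1) => /=; rewrite ?mem_enum//.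
    by apply: BP; case: (hu (phi n)).
  by rewrite -bigcup_seq => -[j _ ?]; exists j.
(* [C] gathers the closed pieces of the other labels. As [l] lies in [K j], it avoids [C], and so
   does a ball around it: outside [B] only the label [j] occurs there. *)
pose C := \big[setU/set0]_(i <- [seq i <- enum 'I_k | i != j]) K i.
have nCl : ~ C l.
  rewrite /C -bigcup_seq => -[i /=]; rewrite mem_filter => /andP[ij _] Kil.
  have [_ /(_ _ Kil)/= qi _] := hK i; have [_ /(_ _ Kjl)/= qj _] := hK j.
  by rewrite -qi qj eqxx in ij.
have [r r0 hr] := cU _ _ nCl.
have near_j x : ~ B x -> d l x < r -> q x = j.
  move=> /BP Kx /hr nC; apply/eqP; apply: contrapT => /negP qj; apply: nC.
  by rewrite -bigcup_seq; exists (q x) => //=; rewrite mem_filter qj mem_enum.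
have r20 : 0 < r / 2 by rewrite divr_gt0.
have [N hN] := (dcvgP md _ _).1 hl _ r20.
have [M _ hM] := near_infty_natSinv_lt (PosNum r20).
pose m := maxn N M.
have phige n : (n <= phi n)%N.
  by elim: n => // n ih; exact: leq_ltn_trans ih (hphi _ _ (ltnSn n)).
have [B1 B2 d12] := hu (phi m); apply.
have h1 := hN m (leq_maxl _ _).
have h2 : (phi m).+1%:R^-1 < r / 2.
  exact: (hM _ (leq_trans (leq_maxr N M) (phige m))).
case: (md) => _ _ dC dtri.
have := dtri l (u (phi m)).1 (u (phi m)).2; rewrite (dC l (u (phi m)).1) => h3.
rewrite (near_j _ B1); last by rewrite dC; move: h1 r0 => /=; lra.
have h4 := le_lt_trans d12 h2.
by rewrite (near_j _ B2)//; move: h1 h4 h3 => /=; lra.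
Qed.

Lemma mfin_ffun_bool (m : nat) (A : 'I_m -> X -> bool) :
  (forall i, measurable [set x | A i x]) ->
  mfin (fun x => [ffun i => A i x] : {ffun 'I_m -> bool}).
Proof.
move=> mA w.
rewrite (_ : _ @^-1` _ = \bigcap_(i in [set: 'I_m]) [set x | A i x = w i]).
  apply: fin_bigcap_measurable; first exact: finite_finset.
  move=> i _; case: (w i); first exact: mA.
  have -> : [set x | A i x = false] = ~` [set x | A i x].
    by apply/seteqP; split => x /= /negP; case: (A i x).
  exact: measurableC.
apply/seteqP; split => x /=.
  by move=> <- i _ /=; rewrite ffunE.
by move=> h; apply/ffunP => i; rewrite ffunE; apply: h.
Qed.

(** Join [p] with the record of which balls of radius [e / 2] of a finite cover contain the point.
    Points with equal records share a ball. *)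
Lemma fine_label (k : nat) (p : X -> 'I_k) e : dcompact d -> mfin p -> 0 < e ->
  exists l (q : X -> 'I_l), [/\ mfin q,
    forall x y, q x = q y -> p x = p y &
    forall x y, q x = q y -> d x y <= e].
Proof.
move=> cd mp e0.
have [s hs] := dcover md cd (divr_gt0 e0 (ltr0Sn _ 1)).
pose D x : {ffun 'I_(size s) -> bool} := [ffun i => d (tnth (in_tuple s) i) x < e / 2].
have mD : mfin D.
  by apply: mfin_ffun_bool => i; apply: dopen_measurable; exact: (dopen_ball md).
pose Z x := (p x, D x).
have mZ : mfin Z by apply: mfin_pair.
exists _, (enum_rank \o Z); split.
- exact: (mfin_comp mu).
- by move=> x y /enum_rank_inj [].
- move=> x y /enum_rank_inj [_ /ffunP Dxy].
  have [z /seq_tnthP[i zi] zx] := hs x.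
  have := Dxy i; rewrite !ffunE -zi zx => /esym zy.
  case: md => _ _ dC dtri; have := dtri x z y; rewrite (dC x z); lra.
Qed.

End Borel.

(** * Integrals of Birkhoff sums and of finite-valued maps *)

Section Integrals.
Context {R : realType} {dsp : measure_display} {X : measurableType dsp}.
Variables (mu : probability X R).

Lemma bounded_integrable (f : X -> R) (M : R) : measurable_fun setT f ->
  (forall x, `|f x| <= M) -> mu.-integrable setT (EFin \o f).
Proof.
move=> mf fM; apply: measurable_bounded_integrable => //.
  by rewrite (le_lt_trans (probability_le1 mu measurableT)) ?ltry.
exists M; split; first by rewrite num_real.
by move=> y My x _; apply: le_trans (fM x) (ltW My).
Qed.

Lemma Rintegral_iter (T : X -> X) (f : X -> R) (M : R) n : T_invariant mu T ->
  measurable_fun setT f -> (forall x, `|f x| <= M) ->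
  \int[mu]_x f (iter n T x) = \int[mu]_x f x.
Proof.
move=> invT mf fM; have mT := measurable_iter invT n.
have mfT : measurable_fun setT (f \o iter n T) by exact: measurableT_comp.
have fTM x : `|(f \o iter n T) x| <= M by exact: fM.
rewrite /Rintegral; congr fine.
have iT : mu.-integrable (iter n T @^-1` setT) ((EFin \o f) \o iter n T).
  by rewrite preimage_setT; exact: (bounded_integrable mfT fTM).
have mEf := (measurable_EFinP setT f).2 mf.
have := integral_pushforward mT mEf iT measurableT.
rewrite preimage_setT => <-; apply: eq_measure_integral => A mA _.
exact: measure_preim.
Qed.

Lemma Rintegral_law (I : finType) (Z : X -> I) (F : I -> R) : mfin Z ->
  \int[mu]_x F (Z x) = \sum_i law mu Z i * F i.
Proof.
move=> mZ.
have mind i : measurable_fun setT (fun x => F i * \1_(Z @^-1` [set i]) x : R).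
  by apply: measurable_funM => //; apply: measurable_indic.
have bind i x : `|F i * \1_(Z @^-1` [set i]) x| <= `|F i| :> R.
  by rewrite normrM indicE; case: (_ \in _); rewrite ?normr1 ?mulr1// normr0 mulr0.
have E x : F (Z x) = \sum_i F i * \1_(Z @^-1` [set i]) x.
  rewrite (bigD1 (Z x))//= big1 ?addr0.
    by rewrite indicE mem_set// mulr1.
  move=> i iZ; rewrite indicE memNset ?mulr0// => /= Zi.
  by rewrite Zi eqxx in iZ.
under eq_Rintegral do rewrite E.
rewrite /Rintegral.
under eq_integral do rewrite -sumEFin.
rewrite integral_sum//; last by move=> i; apply: (bounded_integrable (mind i) (bind i)).
transitivity (fine (\sum_i (law mu Z i * F i)%:E)%E); last by rewrite sumEFin.
congr fine; apply: eq_bigr => i _.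
under eq_integral do rewrite EFinM.
rewrite integralZl//.
  rewrite integral_indic// setIT [RHS]EFinM muleC; congr (_ * _)%E.
  exact/esym/probE.
apply: (@bounded_integrable _ 1); first exact: measurable_indic.
by move=> x; rewrite indicE; case: (_ \in _); rewrite ?normr1 ?normr0.
Qed.

Lemma Rintegral_sum_iter (T : X -> X) (f : X -> R) (M : R) n : T_invariant mu T ->
  measurable_fun setT f -> (forall x, `|f x| <= M) ->
  \int[mu]_x fn T f n x = n%:R * \int[mu]_x f x.
Proof.
move=> invT mf fM.
have mfT i : measurable_fun setT (f \o iter i T).
  by apply: measurableT_comp => //; exact: (measurable_iter invT).
rewrite /Rintegral /fn.
under eq_integral do rewrite -sumEFin.
rewrite integral_sum//; last first.
  by move=> i; apply: (bounded_integrable (mfT i)) => x; exact: fM.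
have -> : \sum_(i < n) (\int[mu]_x (f (iter i T x))%:E)%E =
    \sum_(i < n) (\int[mu]_x f x)%:E.
  apply: eq_bigr => i _; rewrite -(Rintegral_iter i invT mf fM) fineK//.
  by apply: integrable_fin_num => //; apply: (bounded_integrable (mfT i)) => x; exact: fM.
rewrite sumEFin/= sumr_const card_ord -[LHS]mulr_natl//.
Qed.

Lemma integrable_finite_valued (I : finType) (Z : X -> I) (F : I -> R) : mfin Z ->
  mu.-integrable setT (EFin \o (F \o Z)).
Proof.
move=> mZ; apply: (@bounded_integrable _ (\sum_i `|F i|)).
  move=> _ A mA; rewrite setTI.
  have := mfin_pred mu (fun i => `[< A (F i) >]) mZ.
  by congr measurable; apply/seteqP; split => x /= /asboolP.
by move=> x; rewrite /= (bigD1 (Z x))//= lerDl sumr_ge0.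
Qed.

Lemma integrable_fn (T : X -> X) (f : X -> R) (M : R) n : T_invariant mu T ->
  measurable_fun setT f -> (forall x, `|f x| <= M) ->
  mu.-integrable setT (EFin \o fn T f n).
Proof.
move=> invT mf fM; apply: (@bounded_integrable _ (n%:R * M)).
  apply: measurable_sum => i; apply: measurableT_comp => //.
  exact: (measurable_iter invT).
move=> x; rewrite /fn (le_trans (ler_norm_sum _ _ _))//.
rewrite mulr_natl -[in leRHS](card_ord n) -sumr_const.
by apply: ler_sum => i _; exact: fM.
Qed.

End Integrals.

(** * Hamming distance and greedy selection *)

Section Hamming.
Context {R : realType}.

(* Generating function of the Hamming distance to a fixed word. *)
Lemma sum_hamming (n k : nat) (w0 : {ffun 'I_n -> 'I_k}) (c : R) : 0 <= c ->
  \sum_(w : {ffun 'I_n -> 'I_k}) \prod_i (if w i == w0 i then 1 else c)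
    <= (1 + k%:R * c) ^+ n.
Proof.
move=> c0.
rewrite -(bigA_distr_bigA (fun i j => if j == w0 i then 1 else c)).
have -> : (1 + k%:R * c) ^+ n = \prod_(i < n) (1 + k%:R * c).
  by rewrite prodr_const card_ord.
apply: ler_prod => i _.
apply/andP; split; first by apply: sumr_ge0 => j _; case: ifP.
rewrite (bigD1 (w0 i))//= eqxx lerD2l.
apply: (@le_trans _ _ (\sum_(j : 'I_k | j != w0 i) c)).
  by apply: ler_sum => j /negbTE ->.
apply: (@le_trans _ _ (\sum_(j : 'I_k) c)).
  by rewrite [leRHS](bigD1 (w0 i))//= lerDr.
by rewrite sumr_const card_ord mulr_natl.
Qed.

(** Select the element of largest [g], discard all that is near it, and repeat on the rest. Whatever
    is discarded is near a selected element that beats it. *)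
Lemma greedy (I : finType) (S : {set I}) (near : rel I) (g : I -> R) :
  reflexive near -> symmetric near ->
  exists E : {set I}, [/\ E \subset S,
    forall i j, i \in E -> j \in E -> i != j -> ~~ near i j &
    forall i, i \in S -> exists e, [/\ e \in E, near i e & g i <= g e]].
Proof.
move=> rn sn; have [m] := ubnP #|S|; elim: m S => // m ih S cS.
have [->|[i0 i0S]] := set_0Vmem S.
  by exists finset.set0; split => // i; rewrite ?inE// => j; rewrite inE.
pose e := [arg max_(i > i0 in S) g i]%O.
have [eS emax] : e \in S /\ forall i, i \in S -> g i <= g e.
  by rewrite /e; case: arg_maxP.
pose S' := [set i in S | ~~ near i e]%SET.
have S'S : S' \subset S by apply/fintype.subsetP => i; rewrite inE => /andP[].
have [|E [ES' sepE covE]] := ih S'.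
  rewrite -ltnS; apply: leq_trans cS; rewrite ltnS.
  have : S' \proper S.
    by apply/properP; split => //; exists e => //; rewrite inE eS rn.
  exact: proper_card.
exists (e |: E)%SET; split.
- apply/fintype.subsetP => i; rewrite !inE => /predU1P[-> //|iE].
  exact: (fintype.subsetP S'S _ (fintype.subsetP ES' _ iE)).
- have far i : i \in E -> ~~ near i e.
    by move=> /(fintype.subsetP ES'); rewrite inE => /andP[].
  move=> i j; rewrite !inE => /predU1P[->|iE] /predU1P[->|jE].
  + by rewrite eqxx.
  + by rewrite sn => _; exact: far.
  + by move=> _; exact: far.
  + exact: sepE.
- move=> i iS; have [nie|fie] := boolP (near i e).
    by exists e; split; rewrite ?inE ?eqxx ?emax.
  have [|e' [e'E nie' gie']] := covE i; first by rewrite inE iS.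
  by exists e'; split; rewrite ?inE ?e'E ?orbT.
Qed.

End Hamming.

(** * From distinct words to separated points *)

Section Estimate.
Context {R : realType} {dsp : measure_display} {X : measurableType dsp}.
Variables (d : X -> X -> R) (T : X -> X) (f : X -> R).
Hypothesis md : is_metric d.

Lemma dn_le n x y del : 0 <= del ->
  (dn d T n x y <= del) = [forall i : 'I_n, d (iter i T x) (iter i T y) <= del].
Proof.
move=> del0; apply/bigmax_leP/forallP => [[_ h] i|h]; first exact: h.
by split.
Qed.

Lemma le_dn n x y i : (i < n)%N -> d (iter i T x) (iter i T y) <= dn d T n x y.
Proof.
move=> ilt; rewrite /dn.
exact: (@le_bigmax _ _ _ 0 (fun j : 'I_n => d (iter j T x) (iter j T y)) (Ordinal ilt)).
Qed.

Lemma dn_ge0 n x y : 0 <= dn d T n x y.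
Proof. by rewrite /dn; apply/bigmax_geP; left. Qed.

Lemma dnC n x y : dn d T n x y = dn d T n y x.
Proof. by apply: eq_bigr => i _; case: md. Qed.

Lemma dnxx n x : dn d T n x x = 0.
Proof.
apply/eqP; rewrite eq_le dn_ge0 andbT dn_le//; apply/forallP => i.
by case: md => _ h _ _; rewrite (h _ _).2.
Qed.

Section label.
Variables (k : nat) (q : X -> 'I_k) (B : set X) (del s : R).
Hypotheses (del0 : 0 < del) (s0 : 0 <= s).
Hypothesis qB : forall x y, ~ B x -> ~ B y -> d x y <= del -> q x = q y.

(** Of the [2 * s] charged per visit to [B], one [s] enters the weight of the greedy selection and
    the other pays, through [expR_visits], for the letters in which two close orbits may differ. *)
Definition penalised (x : X) : R := f x - 2 * s * \1_B x.

Definition visits n x : R := \sum_(i < n) \1_B (iter i T x).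

Lemma visits_ge0 n x : 0 <= visits n x.
Proof. by apply: sumr_ge0 => i _; rewrite indicE; case: (_ \in _). Qed.

Lemma fn_pen n x : fn T penalised n x = fn T f n x - 2 * s * visits n x.
Proof. by rewrite /fn /penalised sumrB mulr_sumr. Qed.

(** Two orbits that stay within [del] can differ in a letter only at a time when one of them is in
    [B]. The bound is checked time by time once all visits are on the left. *)
Lemma expR_visits n x y : dn d T n x y <= del ->
  expR (- s * visits n x) <= expR (s * visits n y) *
    \prod_i (if word T q n x i == word T q n y i then 1 else expR (- s)).
Proof.
rewrite dn_le; last exact: ltW.
move=> /forallP h.
rewrite -[leRHS]mulrC -ler_pdivrMr ?expR_gt0// -expRN -expRD.
rewrite -mulrN mulNr -mulrN -mulrDr /visits -!sumrN -big_split/= mulr_sumr expR_sum.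
apply: ler_prod => i _; rewrite expR_ge0/=.
rewrite !ffunE.
have [Bx|nBx] := pselect (B (iter i T x)).
  rewrite indicE mem_set//.
  case: ifP => _; rewrite -?[leRHS]expR0 ler_expR indicE;
    case: (_ \in _) => /=; move: s0; lra.
have [By|nBy] := pselect (B (iter i T y)).
  rewrite indicE memNset// indicE mem_set//.
  case: ifP => _; rewrite -?[leRHS]expR0 ler_expR; move: s0 => /=; lra.
rewrite (qB nBx nBy (h i)) eqxx -[leRHS]expR0 ler_expR !indicE !memNset//=; lra.
Qed.

(* Greedy selection by decreasing [f_n - s b], [b] the number of visits to [B]:
   a discarded word is within Hamming distance [b(y) + b(e)] of a selected one. *)
Lemma separated_sum n (S : {set {ffun 'I_n -> 'I_k}}) (y : {ffun 'I_n -> 'I_k} -> X) :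
  (forall A, A \in S -> word T q n (y A) = A) ->
  exists E : {set {ffun 'I_n -> 'I_k}}, [/\ E \subset S,
    forall A A', A \in E -> A' \in E -> A != A' -> del < dn d T n (y A) (y A') &
    \sum_(A in S) expR (fn T penalised n (y A)) <=
      (1 + k%:R * expR (- s)) ^+ n * \sum_(A in E) expR (fn T f n (y A))].
Proof.
move=> yS.
pose near : rel _ := fun A A' => dn d T n (y A) (y A') <= del.
pose g A := fn T f n (y A) - s * visits n (y A).
have rn : reflexive near by move=> A; rewrite /near dnxx ltW.
have sn : symmetric near by move=> A A'; rewrite /near dnC.
have [E [ES sepE covE]] := greedy S g rn sn.
exists E; split => //.
  by move=> A A' AE A'E /(sepE _ _ AE A'E); rewrite /near -ltNge.
(* Bounding by the sum over all of [E] avoids assigning a selected word to each [A]; the term of the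
   one supplied by [covE] is already large enough. *)
have h A : A \in S -> expR (fn T penalised n (y A)) <=
    \sum_(e in E) expR (fn T f n (y e)) *
      \prod_i (if A i == e i then 1 else expR (- s)).
  move=> AS; have [e [eE Ae gAe]] := covE A AS.
  rewrite (bigD1 e)//= ler_wpDr//.
    apply: sumr_ge0 => e' _; apply: mulr_ge0; first exact: expR_ge0.
    by apply: prodr_ge0 => i _; case: ifP => // _; exact: expR_ge0.
  have eS := fintype.subsetP ES _ eE.
  have := expR_visits Ae; rewrite (yS _ AS) (yS _ eS) => hv.
  have -> : fn T penalised n (y A) = g A + (- s * visits n (y A)).
    by rewrite fn_pen /g; ring.
  rewrite expRD (le_trans (ler_wpM2l (expR_ge0 _) hv))//.
  rewrite mulrA ler_wpM2r//.
    by apply: prodr_ge0 => i _; case: ifP => // _; exact: expR_ge0.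
  by rewrite -expRD ler_expR; move: gAe; rewrite /g; lra.
apply: (le_trans (ler_sum _ h)).
rewrite exchange_big/= mulr_sumr; apply: ler_sum => e eE.
rewrite -mulr_sumr mulrC ler_wpM2r ?expR_ge0//.
apply: le_trans (sum_hamming e (expR_ge0 (- s))).
rewrite [leLHS]big_mkcond; apply: ler_sum => A _; case: ifP => // _.
by apply: prodr_ge0 => i _; case: ifP => // _; exact: expR_ge0.
Qed.

End label.
End Estimate.

(** * Fans over a finite horizon *)

Section Horizon.
Context {R : realType} {dsp : measure_display} {X : measurableType dsp}.
Variables (d : X -> X -> R) (T : X -> X) (f : X -> R) (mu : probability X R).
Hypotheses (md : is_metric d) (invT : T_invariant mu T).

(* A lower bound [c] for [P_n(T,f,del,T^-n W)] realised by [m] points, where [W]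
   is the [N]-step approximation of [Ws eps x]. *)
Definition fan m n N (del c eps : R) (x : X) : Prop :=
  exists y : 'I_m -> X, [/\
    forall i t, (t < N)%N -> d (iter t T x) (iter t T (iter n T (y i))) <= eps,
    forall i j, i != j -> del <= dn d T n (y i) (y j) &
    c <= \sum_i expR (fn T f n (y i))].

Variables (k : nat) (q : X -> 'I_k) (B : set X) (del s M : R).
Hypotheses (mq : mfin q) (mB : measurable B) (mf : measurable_fun setT f).
Hypotheses (fM : forall x, `|f x| <= M) (del0 : 0 < del) (s0 : 0 <= s).
Hypothesis qB : forall x y, ~ B x -> ~ B y -> d x y <= del -> q x = q y.

Let pen := penalised f B s.

Let pen_bounded x : `|pen x| <= M + 2 * s.
Proof.
rewrite (le_trans (ler_normB _ _))// lerD//.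
rewrite !normrM ger0_norm// (ger0_norm s0) indicE.
by case: (_ \in _); rewrite ?normr1 ?mulr1 ?normr0 ?mulr0 ?mulr_ge0.
Qed.

Let measurable_pen : measurable_fun setT pen.
Proof.
apply: measurable_funB => //; apply: measurable_funM => //.
Qed.

Lemma Rintegral_pen : \int[mu]_x pen x = \int[mu]_x f x - 2 * s * prob mu B.
Proof.
have iB : mu.-integrable setT (EFin \o (\1_B : X -> R)).
  apply: (@bounded_integrable _ _ _ _ _ 1); first exact: measurable_indic.
  by move=> x; rewrite indicE; case: (_ \in _); rewrite ?normr1 ?normr0.
rewrite /pen /penalised RintegralB//; last first.
- apply: (@bounded_integrable _ _ _ _ _ (2 * s)).
    by apply: measurable_funM => //; exact: measurable_indic.
  move=> x; rewrite !normrM ger0_norm// (ger0_norm s0) indicE.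
  by case: (_ \in _); rewrite ?normr1 ?mulr1 ?normr0 ?mulr0 ?mulr_ge0.
- exact: bounded_integrable fM.
rewrite RintegralZl//; congr (_ - _ * _).
by rewrite /Rintegral integral_indic// setIT.
Qed.

(** The first [n] letters form the word [A]; the next [N] name the cylinder [C] that contains the
    [n]-th iterate. *)
Let cell n N x := (word T q n x, word T q N (iter n T x)).

Let mfin_cell n N : mfin (cell n N).
Proof.
apply: mfin_pair; first exact: (mfin_word invT mq).
exact: (mfin_iter invT n (mfin_word invT mq N)).
Qed.

Arguments mfin_cell : clear implicits.

(** The supremum of a Birkhoff sum over a cell need not be attained. The loss of 1 is independent of
    [n] and [N], hence negligible against [n]. *)
Lemma near_maximal_points n N :
  exists y : {ffun 'I_n -> 'I_k} * {ffun 'I_N -> 'I_k} -> X,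
    forall x, cell n N (y (cell n N x)) = cell n N x /\
      fn T pen n x <= fn T pen n (y (cell n N x)) + 1.
Proof.
have [x0 _] := probability_inhabited mu.
have fnb x : fn T pen n x <= n%:R * (M + 2 * s).
  rewrite /fn mulr_natl -[in leRHS](card_ord n) -sumr_const; apply: ler_sum => i _.
  exact: le_trans (ler_norm _) (pen_bounded _).
suff /choice[y hy] z : exists y, forall x, cell n N x = z ->
    cell n N y = z /\ fn T pen n x <= fn T pen n y + 1.
  by exists y => x; exact: hy.
have [[x1 x1z]|nz] := pselect (exists x, cell n N x = z); last first.
  by exists x0 => x xz; exfalso; apply: nz; exists x.
pose V := [set fn T pen n x | x in [set x | cell n N x = z]].
have hV : has_sup V.
  split; first by exists (fn T pen n x1), x1.
  by exists (n%:R * (M + 2 * s)) => _ [x _ <-].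
have [_ [y yz <-] hy] := sup_adherent ltr01 hV.
exists y => x xz; split=> //.
have : fn T pen n x <= sup V by apply: sup_upper_bound => //; exists x.
by move: hy; lra.
Qed.

Section pressure.
Variables (n N : nat) (y : {ffun 'I_n -> 'I_k} * {ffun 'I_N -> 'I_k} -> X).
Hypothesis yP : forall x, cell n N (y (cell n N x)) = cell n N x /\
      fn T pen n x <= fn T pen n (y (cell n N x)) + 1.

Let p := law mu (cell n N).

(** Partition function of the words that precede [C]. Restricting to cells of positive mass ensures
    that [y (A, C)] really lies in its cell. *)
Definition Zsum (C : {ffun 'I_N -> 'I_k}) : R :=
  \sum_(A | 0 < p (A, C)) expR (fn T pen n (y (A, C))).

Let sum_p C : \sum_A p (A, C) = law mu (word T q N) C.
Proof.
rewrite -(law_iter invT n); last exact: (mfin_word invT mq).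
rewrite -[word T q N \o _]/(snd \o cell n N) (law_comp mu snd (mfin_cell n N)).
transitivity (\sum_A \sum_(C' | C' == C) p (A, C')).
  by apply: eq_bigr => A _; rewrite big_pred1_eq.
by rewrite pair_big_dep/=; apply: eq_bigr => -[].
Qed.

(** Sum [gibbs_pressure] over the cylinders [C]. The entropies give that of [cell] minus [Hw N], at
    least [n * hw] because a cell determines the word of length [n + N]; the energies give the
    integral of the penalised Birkhoff sum, up to 1. *)
Lemma mean_pressure :
  n%:R * (hw mu T q + \int[mu]_x pen x) - 1 <=
  \sum_C law mu (word T q N) C * ln (Zsum C).
Proof.
have h1 C : \sum_A eta_ent (p (A, C)) - eta_ent (law mu (word T q N) C) +
    \sum_A p (A, C) * fn T pen n (y (A, C)) <=
    law mu (word T q N) C * ln (Zsum C).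
  have [c0|] := ltP 0 (law mu (word T q N) C).
    rewrite -!sum_p; apply: gibbs_pressure; last by rewrite sum_p.
    by move=> A; apply: law_ge0.
  move=> c0; have c00 : law mu (word T q N) C = 0.
    by apply/eqP; rewrite eq_le c0 law_ge0.
  have pA A : p (A, C) = 0.
    apply/eqP; rewrite eq_le law_ge0 andbT -c00 -sum_p (bigD1 A)//= lerDl.
    by apply: sumr_ge0 => A' _; apply: law_ge0.
  rewrite c00 mul0r !big1; first by rewrite eta_entE// !mul0r oppr0; lra.
    by move=> A _; rewrite pA mul0r.
  by move=> A _; rewrite pA eta_entE// mul0r oppr0.
apply: le_trans (ler_sum _ (fun C _ => h1 C)).
rewrite big_split sumrB/=.
have pairE (F : {ffun 'I_n -> 'I_k} * {ffun 'I_N -> 'I_k} -> R) :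
    \sum_C \sum_A F (A, C) = \sum_z F z.
  rewrite exchange_big (pair_big predT predT (fun A C => F (A, C)))/=.
  by apply: eq_bigr => -[].
rewrite (pairE (fun z => eta_ent (p z))) (pairE (fun z => p z * fn T pen n (y z))).
have h2 : Hw mu T q (n + N) <= HZ mu (cell n N).
  apply: HZ_le (mfin_cell n N) _ => a b [/wordP ha /wordP hb].
  apply/wordP => i ilt; have [lin|nli] := ltnP i n; first exact: ha.
  rewrite -(subnK nli) !iterD; apply: hb; lia.
have h3 := hw_le invT mq n N; rewrite {2}/Hw /HZ in h3.
have h4 : n%:R * \int[mu]_x pen x - 1 <= \sum_z p z * fn T pen n (y z).
  rewrite -(Rintegral_sum_iter n invT measurable_pen pen_bounded).
  have := Rintegral_law mu (fun z => fn T pen n (y z) + 1) (mfin_cell n N).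
  under [X in _ = X -> _]eq_bigr do rewrite mulrDr mulr1.
  rewrite big_split/= (sum_law mu (mfin_cell n N)) => h.
  rewrite lerBlDr -h; apply: le_Rintegral => //.
  - exact: (integrable_fn _ invT measurable_pen pen_bounded).
  - exact: (integrable_finite_valued _ (fun z => fn T pen n (y z) + 1) (mfin_cell n N)).
  by move=> x _; case: (yP x).
move: h2 h3 h4; rewrite mulrDr /HZ -/p; lra.
Qed.

Lemma Zsum_gt0 C : 0 < law mu (word T q N) C -> 0 < Zsum C.
Proof.
move=> c0; have [A pA] : exists A, 0 < p (A, C).
  apply/existsP; rewrite -[X in is_true X]negbK negb_exists.
  apply/negP => /forallP h.
  move: c0; rewrite -sum_p big1 ?ltxx// => A _.
  by apply/eqP; rewrite eq_le law_ge0 andbT leNgt.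
rewrite /Zsum (bigD1 A)//= ltr_wpDr ?expR_gt0// sumr_ge0//.
Qed.

(** There are at most [k ^ n] words, and the penalty only lowers Birkhoff sums, so the bound is free
    of [s]. *)
Lemma ln_Zsum_le C : 0 < law mu (word T q N) C ->
  ln (Zsum C) <= n%:R * (ln k%:R + M).
Proof.
move=> c0.
have [x0 _] := probability_inhabited mu.
have k0 : (0 < k)%N by case: (k) (q x0) => // -[].
have le1 : Zsum C <= expR (n%:R * (ln k%:R + M)).
  apply: (@le_trans _ _ (\sum_(A : {ffun 'I_n -> 'I_k}) expR (n%:R * M))).
    rewrite /Zsum big_mkcond; apply: ler_sum => A _.
    case: ifP => _; last exact: expR_ge0.
    rewrite ler_expR fn_pen lerBlDr.
    apply: (@le_trans _ _ (n%:R * M)).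
      rewrite /fn mulr_natl -[in leRHS](card_ord n) -sumr_const; apply: ler_sum => i _.
      exact: le_trans (ler_norm _) (fM _).
    by rewrite lerDl !mulr_ge0// visits_ge0.
  rewrite sumr_const card_ffun !card_ord -[leLHS]mulr_natl mulrDr expRD.
  have kE : expR (ln k%:R) = k%:R :> R by rewrite lnK ?posrE ?ltr0n.
  by rewrite natrX -[in leLHS]kE -expRM_natl.
by rewrite -[leRHS]expRK ler_ln ?posrE ?expR_gt0 ?Zsum_gt0.
Qed.

(** Reverse Markov inequality: [ln (Zsum C)] is below [n * a] off the good cylinders and below its
    maximum on them, so a large mean forces good cylinders to have mass. *)
Lemma good_words (a : R) (good := fun C =>
    (0 < law mu (word T q N) C) && (n%:R * a <= ln (Zsum C))) :
  n%:R * (hw mu T q + \int[mu]_x pen x - a) - 1 <=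
  n%:R * (ln k%:R + M - a) * prob mu [set x | good (word T q N x)].
Proof.
have mw := mfin_word invT mq N.
have := mean_pressure; rewrite (prob_pred mu good mw).
set S := \sum_C _; set G := \sum_(C | _) _.
have : S <= n%:R * a + n%:R * (ln k%:R + M - a) * G.
  have -> : n%:R * a = \sum_C n%:R * a * law mu (word T q N) C.
    by rewrite -mulr_sumr (sum_law mu mw) mulr1.
  rewrite /G mulr_sumr.
  rewrite [X in _ <= _ + X]big_mkcond -big_split/=; apply: ler_sum => C _.
  have [c0|c0] := ltP 0 (law mu (word T q N) C); last first.
    have -> : law mu (word T q N) C = 0 by apply/eqP; rewrite eq_le c0 law_ge0.
    by rewrite mul0r mulr0 add0r; case: ifP; rewrite ?mulr0.
  rewrite /good c0/=; case: ifP => h.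
    by have := ler_wpM2l (ltW c0) (ln_Zsum_le c0); lra.
  move/negbT: h; rewrite -ltNge => /ltW/(ler_wpM2l (ltW c0)); lra.
rewrite !mulrBr mulrDr; lra.
Qed.

End pressure.

(** Over a good cylinder, [separated_sum] thins the points [y (A, C)] to a fan. The cardinality
    bound is independent of [N], as compactness in the horizon will require. *)
Lemma horizon_estimate n N (a eps : R) : (forall x y, q x = q y -> d x y <= eps) ->
  exists G : set X, [/\ measurable G,
    n%:R * (hw mu T q + \int[mu]_x pen x - a) - 1 <=
      n%:R * (ln k%:R + M - a) * prob mu G &
    forall x, G x -> exists2 m, (m <= k ^ n)%N &
      fan m n N del (expR (n%:R * a) / (1 + k%:R * expR (- s)) ^+ n) eps x].
Proof.
move=> qe; have [y yP] := near_maximal_points n N.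
eexists; split; [|exact: (good_words yP a)|].
  exact: (mfin_pred mu (fun C => (0 < law mu (word T q N) C) &&
    (n%:R * a <= ln (Zsum y C))) (mfin_word invT mq N)).
move=> x /= /andP[c0 hZ]; set C := word T q N x in c0 hZ.
pose S := [set A | 0 < law mu (cell n N) (A, C)]%SET.
have yC A : A \in S -> cell n N (y (A, C)) = (A, C).
  rewrite inE => pA; have [z zAC] : exists z, cell n N z = (A, C).
    apply: contrapT => h; move: pA; rewrite /law.
    rewrite (_ : _ @^-1` _ = set0) ?prob0 ?ltxx//.
    by rewrite -subset0 => z zz; apply: h; exists z.
  by have [+ _] := yP z; rewrite zAC.
have yS A : A \in S -> word T q n (y (A, C)) = A by move=> /yC [].
have [E [ES sepE sumE]] := separated_sum f md del0 s0 qB yS.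
exists #|E|.
  by rewrite (leq_trans (max_card _))// card_ffun !card_ord.
exists (fun i => y (enum_val i, C)); split.
(* The letters read after time [n] are those of [x], and points with equal labels are within
   [eps]. *)
- move=> i t tN; have /yC [_ /wordP h] := fintype.subsetP ES _ (enum_valP i).
  by apply: qe; rewrite -h.
- move=> i j ij; apply/ltW/sepE; rewrite ?enum_valP//.
  by rewrite (inj_eq enum_val_inj).
rewrite ler_pdivrMr; last first.
  by rewrite exprn_gt0// ltr_wpDr// mulr_ge0// expR_ge0.
rewrite [leRHS]mulrC -(big_enum_val (fun A => expR (fn T f n (y (A, C))))).
apply: le_trans sumE.
have Z0 : 0 < Zsum y C by exact: Zsum_gt0.
apply: (@le_trans _ _ (Zsum y C)).
  by rewrite -[leRHS]lnK ?posrE// ler_expR.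
by rewrite le_eqVlt; apply/orP; left; apply/eqP; apply: eq_bigl => A; rewrite inE.
Qed.

End Horizon.

(** * Infinite horizon and lower bounds for [Ps] *)

Section StableFans.
Context {R : realType} {dsp : measure_display} {X : measurableType dsp}.
Variables (d : X -> X -> R) (T : X -> X) (f : X -> R).
Hypotheses (md : is_metric d) (cd : dcompact d).
Hypotheses (cT : dcontinuous d T) (cf : dcontinuous_real d f).

Lemma cvg_sum_seq (I : Type) (s : seq I) (u : I -> nat -> R) (l : I -> R) :
  (forall i, u i @ \oo --> l i) ->
  (fun n => \sum_(i <- s) u i n) @ \oo --> \sum_(i <- s) l i.
Proof.
move=> ul; elim: s => [|i s ih].
  by rewrite big_nil; under eq_fun do rewrite big_nil; exact: cvg_cst.
by rewrite big_cons; under eq_fun do rewrite big_cons; exact: cvgD.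
Qed.

Lemma cvg_fn n u l : dcvg d u l -> (fun j => fn T f n (u j)) @ \oo --> fn T f n l.
Proof.
move=> ul; apply: (cvg_sum_seq (u := fun (i : 'I_n) j => f (iter i T (u j)))) => i.
exact: (dcvg_fun md cf (dcvg_iter md i cT ul)).
Qed.

Lemma dn_limit_ge n u v l m del : 0 < del -> dcvg d u l -> dcvg d v m ->
  (forall j, del <= dn d T n (u j) (v j)) -> del <= dn d T n l m.
Proof.
move=> del0 ul vm h; rewrite leNgt; apply/negP => /bigmax_ltP[_ hlt].
have /choice[N hN] (i : 'I_n) : exists N, forall j, (N <= j)%N ->
    d (iter i T (u j)) (iter i T (v j)) < del.
  have := dcvg_dist md (dcvg_iter md i cT ul) (dcvg_iter md i cT vm).
  by move=> /cvgr_lt/(_ _ (hlt i isT))[N _ hN]; exists N.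
have := h (\max_i N i); rewrite leNgt => /negP; apply.
by apply/bigmax_ltP; split => // i _; apply: hN; exact: leq_bigmax.
Qed.

(** Separation is weak, so that it passes to limits; [sfan_Pn] recovers the strict form by halving
    [del]. *)
Definition sfan m n (del c eps : R) (x : X) : Prop :=
  exists y : 'I_m -> X, [/\
    forall i, Ws d T eps x (iter n T (y i)),
    forall i j, i != j -> del <= dn d T n (y i) (y j) &
    c <= \sum_i expR (fn T f n (y i))].

(** All [m] points converge along one subsequence, and each condition involves finitely many times
    at once. Letting base point and horizon vary together yields both [sfan_closed] and
    [fan_sfan]. *)
Lemma sfan_limit m n del c eps u x : 0 < del -> dcvg d u x ->
  (forall j, fan d T f m n j del c eps (u j)) -> sfan m n del c eps x.
Proof.
move=> del0 ux /choice[y hy].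
have [phi [l [hphi hl]]] := dcompact_seq md (enum 'I_m) y cd.
have {}hl i : dcvg d (fun j => y (phi j) i) (l i) by apply: hl; rewrite mem_enum.
have uphi := dcvg_sub md hphi ux.
exists l; split.
- move=> i t /=.
  have := dcvg_dist md (dcvg_iter md t cT uphi)
    (dcvg_iter md t cT (dcvg_iter md n cT (hl i))).
  move=> h; apply: (ler_cvg_to h (cvg_cst _)).
  (* An extraction satisfies [j <= phi j], so the horizon [phi j] exceeds [t] as soon as [j]
     does. *)
  exists t.+1 => // j /= tj; have [+ _ _] := hy (phi j); apply.
  apply: leq_trans tj _.
  by elim: (j) => // a ih; exact: leq_ltn_trans ih (hphi _ _ (ltnSn a)).
- move=> i j ij; apply: (dn_limit_ge del0 (hl i) (hl j)) => a.
  by have [_ + _] := hy (phi a); apply.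
- have h : (fun j => \sum_i expR (fn T f n (y (phi j) i))) @ \oo -->
      \sum_i expR (fn T f n (l i)).
    apply: (cvg_sum_seq (u := fun i j => expR (fn T f n (y (phi j) i)))
      (l := fun i => expR (fn T f n (l i)))) => i.
    apply: (cvg_comp (fun j => fn T f n (y (phi j) i)) (@expR R) (cvg_fn (hl i))).
    exact: continuous_expR.
  apply: (ler_cvg_to (cvg_cst _) h); apply: nearW => j.
  by have [] := hy (phi j).
Qed.

Lemma sfan_fan m n N del c eps x : sfan m n del c eps x -> fan d T f m n N del c eps x.
Proof. by move=> [y [h1 h2 h3]]; exists y; split => // i t _; exact: h1. Qed.

Lemma sfan_closed m n del c eps : 0 < del -> dclosed d (sfan m n del c eps).
Proof.
move=> del0; apply/(dclosedP md) => u l hu ul.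
by apply: (sfan_limit del0 ul) => j; exact: sfan_fan.
Qed.

Lemma fan_horizon m n N N' del c eps x : (N <= N')%N ->
  fan d T f m n N' del c eps x -> fan d T f m n N del c eps x.
Proof.
move=> NN' [y [h1 h2 h3]]; exists y; split => // i t tN; apply: h1.
exact: leq_trans tN NN'.
Qed.

(** If every [m] failed, each [m <= K] would fail at some horizon, and all would fail at the largest
    of these [K.+1] horizons. *)
Lemma fan_sfan K n del c eps x : 0 < del ->
  (forall N, exists2 m, (m <= K)%N & fan d T f m n N del c eps x) ->
  exists m, sfan m n del c eps x.
Proof.
move=> del0 h; apply: contrapT => nh.
have /choice[N hN] m : exists N, ~ fan d T f m n N del c eps x.
  apply: contrapT => hm; apply: nh; exists m.
  apply: (sfan_limit del0 (dcvg_cst md x)) => j.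
  by apply: contrapT => hj; apply: hm; exists j.
have [m mK fm] := h (\max_(i < K.+1) N i).
apply: (hN m); apply: fan_horizon fm.
exact: (@leq_bigmax _ (fun i : 'I_K.+1 => N i) (Ordinal (mK : (m < K.+1)%N))).
Qed.

Lemma sfan_le m n del c c' eps x : c' <= c -> sfan m n del c eps x ->
  sfan m n del c' eps x.
Proof. by move=> cc [y [h1 h2 h3]]; exists y; split => //; exact: le_trans h3. Qed.

Lemma fan_le m n N del c c' eps x : c' <= c -> fan d T f m n N del c eps x ->
  fan d T f m n N del c' eps x.
Proof. by move=> cc [y [h1 h2 h3]]; exists y; split => //; exact: le_trans h3. Qed.

(** The same points serve for [T x] at time [n.+1]: stable sets are mapped forward, separation
    persists, and the new term of the Birkhoff sum is at least [- M]. *)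
Lemma sfan_succ M m n del c eps x : (forall x, `|f x| <= M) ->
  sfan m n del c eps x -> sfan m n.+1 del (c * expR (- M)) eps (T x).
Proof.
move=> fM [y [h1 h2 h3]]; exists y; split.
- move=> i t.
  have h : d (iter t.+1 T x) (iter t.+1 T (iter n T (y i))) <= eps := h1 i t.+1.
  by rewrite !iterSr in h.
- move=> i j /h2 h; apply: (le_trans h); apply: bigmax_le; first exact: dn_ge0.
  by move=> t _; apply: le_dn; apply: (leq_trans (ltn_ord t)).
- apply: (le_trans (ler_wpM2r (expR_ge0 _) h3)).
  rewrite mulr_suml; apply: ler_sum => i _; rewrite -expRD ler_expR.
  rewrite /fn [leRHS]big_ord_recr/= lerD2l.
  by have := fM (iter n T (y i)); rewrite ler_norml => /andP[].
Qed.

Lemma sfan_Pn m n del c eps x : 0 < del -> sfan m n del c eps x ->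
  (c%:E <= Pn d T f n (del / 2) (iter n T @^-1` Ws d T eps x))%E.
Proof.
move=> del0 [y [h1 h2 h3]].
have inj_y : injective y.
  move=> i j yij; apply/eqP; apply: contrapT => /negP /h2.
  by rewrite yij dnxx// leNgt del0.
apply: (@le_trans _ _ (\sum_(z <- map y (enum 'I_m)) expR (fn T f n z))%:E).
  by rewrite lee_fin big_map big_enum.
apply: ereal_sup_ubound; exists (map y (enum 'I_m)) => //; split.
- by rewrite map_inj_uniq// enum_uniq.
- by move=> z /mapP[i _ ->]; exact: h1.
- move=> z z' /mapP[i _ ->] /mapP[j _ ->] yij.
  have /h2 : i != j by apply: contra yij => /eqP->.
  by apply: lt_le_trans; lra.
Qed.

Lemma limn_esup_ge (u : nat -> \bar R) (a C : R) :
  (forall n, exists2 j, (n < j)%N & ((a - C / j%:R)%:E <= u j)%E) ->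
  (a%:E <= limn_esup u)%E.
Proof.
move=> h; apply/lee_subgt0Pr => e e0; rewrite limn_esup_lim.
apply: lime_ge; first exact: is_cvg_esups.
apply: nearW => n.
pose K := Num.truncn (`|C| / e).
have [j nj hj] := h (maxn n K).
apply: (@le_trans _ _ (u j)); last first.
  apply: ereal_sup_ubound; exists j => //=.
  by apply: leq_trans (ltnW nj); exact: leq_maxl.
apply: le_trans hj; rewrite -EFinB lee_fin lerD2l lerN2.
have j0 : 0 < j%:R :> R by rewrite ltr0n; exact: leq_ltn_trans (leq0n _) nj.
rewrite ler_pdivrMr//; apply: (le_trans (ler_norm _)).
rewrite mulrC -ler_pdivrMr//.
apply: ltW; apply: lt_le_trans (truncnS_gt _) _; rewrite ler_nat.
by apply: leq_ltn_trans nj; exact: leq_maxr.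
Qed.

Lemma Pn_anti n del del' K : del <= del' -> (Pn d T f n del' K <= Pn d T f n del K)%E.
Proof.
move=> dd; apply: ereal_sup_le => _ [E [uE EK sE] <-].
exists E => //; split => // x y xE yE /(sE _ _ xE yE); exact: le_lt_trans.
Qed.

Lemma limn_esup_le (u v : nat -> \bar R) : (forall n, (u n <= v n)%E) ->
  (limn_esup u <= limn_esup v)%E.
Proof.
move=> uv; rewrite !limn_esup_lim; apply: lee_lim; [exact: is_cvg_esups..|].
apply: nearW => n; apply: ge_ereal_sup => _ [j nj <-].
by apply: le_trans (uv j) _; apply: ereal_sup_ubound; exists j.
Qed.

Lemma le_Pn n del K K' : K `<=` K' -> (Pn d T f n del K <= Pn d T f n del K')%E.
Proof.
move=> KK; apply: ereal_sup_le => _ [E [uE EK sE] <-].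
by exists E => //; split => // x /EK /KK.
Qed.

Lemma Pn_ge0 n del K : (0 <= Pn d T f n del K)%E.
Proof.
apply: ereal_sup_ubound; exists [::]; last by rewrite big_nil.
by split.
Qed.

Definition growth (del : R) (K : nat -> set X) : \bar R :=
  limn_esup (fun n => ((n%:R)^-1)%:E * lne (Pn d T f n del (K n)))%E.

Lemma growth_le del del' (K K' : nat -> set X) :
  (forall n, Pn d T f n del (K n) <= Pn d T f n del' (K' n))%E ->
  (growth del K <= growth del' K')%E.
Proof.
move=> h; apply: limn_esup_le => n; apply: lee_wpmul2l.
  by rewrite lee_fin invr_ge0.
by rewrite lee_lne// in_itv/= Pn_ge0 leey.
Qed.

(** By monotonicity in [del] the limit at 0 is a supremum, so a single [del] suffices for a lower
    bound. *)
Lemma PsE x eps : Ps d T f x eps =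
  ereal_sup [set growth del (fun n => iter n T @^-1` Ws d T eps x) |
    del in [set` Interval (BRight (0:R)) +oo%O]].
Proof.
apply: cvg_lim => //; apply: (nonincreasing_at_right_cvge +oo%O) => //.
by move=> r r' _ _ rr; apply: growth_le => n; exact: Pn_anti.
Qed.

Lemma Ps_ge x eps del (a C : R) : 0 < del ->
  (forall n, exists2 j, (n < j)%N &
     exists m, sfan m j del (expR (j%:R * a - C)) eps x) ->
  (a%:E <= Ps d T f x eps)%E.
Proof.
move=> del0 h; rewrite PsE.
apply: (@le_trans _ _ (growth (del / 2) (fun n => iter n T @^-1` Ws d T eps x))).
  apply: (@limn_esup_ge _ _ C) => n; have [j nj [m hm]] := h n; exists j => //.
  have j0 : 0 < j%:R :> R by rewrite ltr0n; exact: leq_ltn_trans (leq0n _) nj.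
  have := sfan_Pn del0 hm.
  rewrite -lee_lne; last 2 first.
  - by rewrite in_itv/= lee_fin expR_ge0 leey.
  - by rewrite in_itv/= Pn_ge0 leey.
  rewrite lne_EFin ?expR_gt0// expRK => hP.
  have -> : (a - C / j%:R)%:E = ((j%:R^-1)%:E * (j%:R * a - C)%:E)%E.
    by rewrite -EFinM mulrBr mulKf ?gt_eqF// mulrC.
  by apply: lee_wpmul2l => //; rewrite lee_fin invr_ge0 ltW.
apply: ereal_sup_ubound; exists (del / 2) => //=.
by rewrite in_itv/= divr_gt0.
Qed.

Lemma le_Ps x eps eps' : eps <= eps' -> (Ps d T f x eps <= Ps d T f x eps')%E.
Proof.
move=> ee; rewrite !PsE; apply: ge_ereal_sup => _ [del del0 <-].
apply: (@le_trans _ _ (growth del (fun n => iter n T @^-1` Ws d T eps' x))).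
  apply: growth_le => n; apply: le_Pn => y /= h t; exact: le_trans (h t) ee.
by apply: ereal_sup_ubound; exists del.
Qed.

(** By monotonicity in [eps] the limit is an infimum; testing it on a sequence keeps the exceptional
    null sets countable in number. *)
Lemma lim_Ps_ge x (l : \bar R) :
  (forall m : nat, (l <= Ps d T f x (m.+1%:R^-1)))%E -> (l <= lim_Ps d T f x)%E.
Proof.
move=> h; rewrite /lim_Ps.
have -> : lim (Ps d T f x @ 0^'+) = ereal_inf [set Ps d T f x eps |
    eps in [set` Interval (BRight (0:R)) +oo%O]].
  apply: cvg_lim => //; apply: (nondecreasing_at_right_cvge +oo%O) => //.
  by move=> r r' _ _; exact: le_Ps.
apply: le_ereal_inf_tmp => z [eps /=]; rewrite in_itv/= andbT => eps0 <-.
have [N _ hN] := near_infty_natSinv_lt (PosNum eps0).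
by apply: le_trans (h N) _; apply: le_Ps; apply: ltW; exact: (hN N (leqnn N)).
Qed.

End StableFans.

(** * Ergodicity and forward invariant sets *)

Section Ergodic.
Context {R : realType} {dsp : measure_display} {X : measurableType dsp}.
Variables (mu : probability X R) (T : X -> X).
Hypotheses (invT : T_invariant mu T) (ergT : ergodic mu T).

(** The preimages of [A] increase and all have its measure; their union is strictly invariant and
    still of measure [mu A]. *)
Lemma ergodic_forward A : measurable A -> (forall x, A x -> A (T x)) ->
  (0 < mu A)%E -> mu A = 1%E.
Proof.
move=> mA TA A0; pose F n := iter n T @^-1` A.
have mF n : measurable (F n) by exact: (measurable_preim invT).
have mUF : measurable (\bigcup_n F n) by exact: bigcupT_measurable.
have FS n : F n `<=` F n.+1 by move=> x; exact: TA.
have muF n : mu (F n) = mu A by exact: (measure_preim invT).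
have UFE : mu (\bigcup_n F n) = mu A.
  have h : {homo F : n m / (n <= m)%N >-> (n <= m)%O}.
    apply: homo_leq => [B|B C D|n]; [exact: lexx|exact: le_trans|].
    by apply/subsetPset; exact: FS.
  have := nondecreasing_cvg_mu (mu := mu) mF mUF h.
  move=> /cvg_lim <-//; rewrite (_ : mu \o F = fun=> mu A); last exact/funext.
  by apply: cvg_lim => //; exact: cvg_cst.
have TF : T @^-1` (\bigcup_n F n) = \bigcup_n F n.
  apply/seteqP; split => x [n _ Fx].
    by exists n.+1 => //; rewrite /F /= -iterS iterSr.
  by exists n => //; have := FS n x Fx; rewrite /F /= -iterS iterSr.
have [h|h] := ergT mUF TF; last by rewrite -UFE.
by move: A0; rewrite -UFE h ltxx.
Qed.

Lemma le_mu_limsup (F : nat -> set X) (c : \bar R) n0 : (forall n, measurable (F n)) ->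
  (forall n, (n0 <= n)%N -> c <= mu (F n))%E -> (c <= mu (lim_sup_set F))%E.
Proof.
move=> mF hF.
have mU n : measurable (\bigcup_(k in [set k | (n <= k)%N]) F k).
  exact: bigcup_measurable.
have h := lim_sup_set_cvg mu F mF.
have fin : (mu (\bigcup_(k in [set k | (0 <= k)%N]) F k) < +oo)%E.
  by rewrite (le_lt_trans (probability_le1 mu (mU 0%N))) ?ltry.
rewrite -(cvg_lim _ (h fin))//.
apply: lime_ge; first by apply: cvgP; exact: h fin.
exists n0 => // n /= n0n; apply: (le_trans (hF _ n0n)).
by rewrite le_measure ?inE//; apply: bigcup_sup => /=.
Qed.

End Ergodic.

(** * Growth of stable fans at almost every point *)

Section Main.
Context {R : realType} {dsp : measure_display} {X : measurableType dsp}.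
Variables (d : X -> X -> R) (T : X -> X) (f : X -> R) (mu : probability X R).
Hypotheses (md : is_metric d) (cd : dcompact d) (bd : borel_of_d d).
Hypotheses (cT : dcontinuous d T) (cf : dcontinuous_real d f).
Hypotheses (invT : T_invariant mu T) (ergT : ergodic mu T).

Lemma dcontinuous_measurable : measurable_fun setT f.
Proof.
apply: (measurability _ (RGenOInfty.measurableE R)).
move=> _ [_ [r ->] <-]; rewrite setTI; apply: (dopen_measurable bd).
move=> x /=; rewrite in_itv/= andbT => rx.
have fr0 : 0 < f x - r by rewrite subr_gt0.
have [del del0 h] := @cf x _ fr0.
exists del => // y /h /=; rewrite in_itv/= andbT ltr_norml; lra.
Qed.

(** Greedy selection then costs at most [th] per unit of time. The choice [s = k / th] works because
    [expR s >= 1 + s]. *)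
Lemma penalty_exists (k : nat) (th : R) : 0 < th ->
  exists2 s, 0 <= s & 1 + k%:R * expR (- s) <= expR th.
Proof.
move=> th0; exists (k%:R / th); first by rewrite divr_ge0// ltW.
apply: le_trans (expR_ge1Dx th); rewrite lerD2l expRN ler_pdivrMr ?expR_gt0//.
apply: (@le_trans _ _ (th * (1 + k%:R / th))).
  by rewrite mulrDr mulr1 mulrCA divff ?gt_eqF// mulr1 lerDr ltW.
by rewrite ler_pM2l// expR_ge1Dx.
Qed.

(** The slack [C] absorbs the loss in [sfan_succ], so that a union over [C] of limit superior sets
    is forward invariant. *)
Definition growing del eps (a C : R) n : set X :=
  [set x | exists m, sfan d T f m n del (expR (n%:R * a - C)) eps x].

Lemma measurable_growing del eps a C n : 0 < del -> measurable (growing del eps a C n).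
Proof.
move=> del0.
have -> : growing del eps a C n =
    \bigcup_m (sfan d T f m n del (expR (n%:R * a - C)) eps).
  by apply/seteqP; split => x [m] => [|_] h; exists m.
apply: bigcupT_measurable => m; apply: (dclosed_measurable bd).
exact: sfan_closed.
Qed.

Lemma growing_prob (k : nat) (P : 'I_k -> set X) (a eps : R) : mpartition P ->
  a < h_part mu T P + \int[mu]_x f x -> 0 < eps ->
  exists del c n0, [/\ 0 < del, 0 < c &
    forall n, (n0 <= n)%N -> c <= prob mu (growing del eps a 0 n)].
Proof.
move=> /mpartition_label[p mp Pp] ah eps0.
rewrite (h_partE invT mp Pp) in ah.
have [l [q [mq qp qd]]] := fine_label mu md bd cd mp eps0.
have hpq := hw_le_refine invT mp mq qp.
set If := \int[mu]_x f x in ah.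
(* The gap is cut into four shares: the mean penalty, the selection factor, the error [- 1], and
   what remains to bound the measure from below. *)
pose th := (hw mu T p + If - a) / 4.
have th0 : 0 < th by rewrite divr_gt0// subr_gt0.
have [s s0 hs] := penalty_exists l th0.
(* [B] is chosen after [s], small enough for a mean penalty of at most [th]; the [+ 1] covers
   [s = 0]. *)
have e0 : 0 < th / (2 * s + 1) by rewrite divr_gt0// ltr_wpDl// mulr_ge0.
have [B [del [mB pB del0 qB]]] := label_near_constant mu md bd cd mq e0.
have mf := dcontinuous_measurable.
have [M fM] := dbounded md cd cf.
have sB : 2 * s * prob mu B <= th.
  apply: (@le_trans _ _ ((2 * s + 1) * prob mu B)).
    by rewrite ler_wpM2r ?prob_ge0// lerDl.
  by rewrite mulrC -ler_pdivlMr// ltr_wpDl// mulr_ge0.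
pose D := ln l%:R + M - (a + th).
(* From [n0] on, [n * th] is at least 1. The constant comes from
   [n * th <= n * D * prob mu (G N)]. *)
exists del, (th / (`|D| + 1)), (Num.truncn th^-1).+1; split => //.
  by rewrite divr_gt0// ltr_wpDl.
move=> n n0n.
have nth : 1 <= n%:R * th.
  rewrite -ler_pdivrMr// div1r; apply: ltW.
  by apply: lt_le_trans (truncnS_gt _) _; rewrite ler_nat.
have n0 : 0 < n%:R :> R by rewrite ltr0n; exact: leq_ltn_trans n0n.
have /choice[G hG] N := horizon_estimate md invT mq mB mf fM del0 s0 qB n N (a + th) qd.
have mG N : measurable (G N) by case: (hG N).
have pG N : th / (`|D| + 1) <= prob mu (G N).
  have [_ + _] := hG N; rewrite (Rintegral_pen _ mB mf fM s0) -/If -/D => h.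
  have h1 : n%:R * th <= n%:R * D * prob mu (G N).
    apply: le_trans h; rewrite lerBrDr; apply: (@le_trans _ _ (n%:R * (2 * th))).
      by rewrite mulr2n mulrDl mul1r mulrDr lerD2l.
    rewrite ler_pM2l//; move: hpq sB; rewrite /th; lra.
  rewrite -mulrA ler_pM2l// in h1.
  rewrite ler_pdivrMr ?ltr_wpDl// mulrC; apply: (le_trans h1).
  by rewrite ler_wpM2r ?prob_ge0// (le_trans (ler_norm _))// lerDl.
(* A fan over a long horizon is one over any shorter horizon, so membership in infinitely many [G N]
   gives fans over all horizons. *)
have sub : lim_sup_set G `<=` growing del eps a 0 n.
  move=> x hx; apply: (fan_sfan (K := (l ^ n)%N) md cd cT cf del0) => N.
  have [N' NN' Gx] := hx N I.
  have [_ _ /(_ x Gx)[m mK fm]] := hG N'; exists m => //.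
  apply: (fan_horizon NN'); apply: fan_le fm.
  rewrite subr0 ler_pdivlMr ?exprn_gt0 ?ltr_wpDr ?mulr_ge0 ?expR_ge0//.
  rewrite mulrDr expRD ler_pM2l ?expR_gt0// expRM_natl.
  by rewrite lerXn2r ?nnegrE ?expR_ge0// addr_ge0// mulr_ge0// expR_ge0.
have mL : measurable (lim_sup_set G).
  apply: bigcapT_measurable => j; exact: bigcup_measurable.
apply: le_trans (le_prob mu mL (measurable_growing _ _ _ _ del0) sub).
rewrite -lee_fin probE//; apply: (@le_mu_limsup _ _ _ mu G _ 0%N) => // N _.
by rewrite -probE// lee_fin.
Qed.

Lemma ae_Ps_ge (a eps : R) : (a%:E < P_mu mu T f)%E -> 0 < eps ->
  {ae mu, forall x, (a%:E <= Ps d T f x eps)%E}.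
Proof.
move=> aP eps0.
have mf := dcontinuous_measurable.
have [M fM] := dbounded md cd cf.
have [k [P [mP aPk]]] : exists k (P : 'I_k -> set X),
    mpartition P /\ a < h_part mu T P + \int[mu]_x f x.
  move: aP; rewrite /P_mu.
  have -> : (\int[mu]_x (f x)%:E)%E = (\int[mu]_x f x)%:E.
    by rewrite /Rintegral fineK// integrable_fin_num//; exact: bounded_integrable fM.
  rewrite -lteBlDr// -EFinB => /ereal_sup_gt[_ [k [P [mP ->]]]].
  by rewrite lte_fin ltrBlDr => h; exists k, P.
have [del [c [n0 [del0 c0 hc]]]] := growing_prob mP aPk eps0.
pose L C := lim_sup_set (growing del eps a C).
have mL C : measurable (L C).
  apply: bigcapT_measurable => j; apply: bigcup_measurable => i _.
  exact: measurable_growing.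
pose A := \bigcup_(j : nat) L j%:R.
have mA : measurable A by apply: bigcupT_measurable => j; exact: mL.
have TA x : A x -> A (T x).
  (* Passing from [i] to [i.+1] raises the target exponent by [a] and loses up to [M]; [j'] exceeds
     [j] by more than [a + M]. *)
  move=> [j _ Lx]; pose j' := (j + (Num.truncn `|a + M|%R).+1)%N.
  exists j' => // n _; have [i ni [m hm]] := Lx n I.
  exists i.+1 => /=; first exact: leq_trans ni _.
  exists m; have := sfan_succ fM hm; apply: sfan_le.
  rewrite -expRD ler_expR -natr1 mulrDl mul1r /j' natrD.
  have := ltW (truncnS_gt `|a + M|); have := ler_norm (a + M); lra.
have A1 : mu A = 1%E.
  apply: (ergodic_forward invT ergT mA TA).
  apply: (@lt_le_trans _ _ (mu (L 0))).
    apply: (@lt_le_trans _ _ c%:E); first by rewrite lte_fin.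
    apply: (@le_mu_limsup _ _ _ mu _ _ n0) => [n|n nn0].
      exact: measurable_growing.
    by rewrite -probE ?lee_fin ?hc//; exact: measurable_growing.
  by rewrite le_measure ?inE// => x Lx; exists 0%N.
exists (~` A); split.
- exact: measurableC.
- by rewrite probability_setC// A1 subee.
- move=> x /= nx Ax; apply: nx; have [j _ Lx] := Ax.
  apply: (Ps_ge (C := j%:R) md del0) => n.
  by have [i ni hi] := Lx n.+1 I; exists i.
Qed.

(** Countably many real levels reduce the theorem to [ae_Ps_ge], including the case of infinite
    entropy. *)
Lemma ereal_approx (z : \bar R) : z != -oo%E ->
  exists u : nat -> R, (forall n, (u n)%:E < z)%E /\
    forall l, (forall n, (u n)%:E <= l)%E -> (z <= l)%E.
Proof.
case: z => [r| |//] _.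
  exists (fun n => r - n.+1%:R^-1); split=> [n|l h].
    by rewrite lte_fin ltrBlDr ltrDl invr_gt0.
  apply/lee_subgt0Pr => e e0; have [N _ hN] := near_infty_natSinv_lt (PosNum e0).
  apply: le_trans (h N); rewrite -EFinB lee_fin lerD2l lerN2; apply: ltW.
  exact: (hN N (leqnn N)).
exists (fun n => n%:R); split=> [n|l h]; first by rewrite ltry.
case: l h => [r h| |/(_ 0%N)//] //.
have := h (Num.truncn r).+1; rewrite lee_fin leNgt => /negP[].
exact: truncnS_gt.
Qed.

Lemma ae_lim_Ps_ge : {ae mu, forall x, (P_mu mu T f <= lim_Ps d T f x)%E}.
Proof.
have [PNy|/ereal_approx[u [uP hu]]] := eqVneq (P_mu mu T f) -oo%E.
  by apply: nearW => x; rewrite PNy leNye.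
have h n m : mu.-negligible [set x | ~ ((u n)%:E <= Ps d T f x m.+1%:R^-1)%E].
  by apply: ae_Ps_ge; rewrite ?invr_gt0.
have := negligible_bigcup (fun n => negligible_bigcup (h n)).
apply: negligibleS => x /= nx; apply: contrapT => hx; apply: nx.
apply: hu => n; apply: lim_Ps_ge => m; apply: contrapT => hnm; apply: hx.
by exists n => //; exists m.
Qed.

End Main.

Unset Implicit Arguments.

Theorem theorem5p4 (R : realType) (dsp : measure_display) (X : measurableType dsp)
  (d : X -> X -> R) (T : X -> X) (f : X -> R) (mu : probability X R) :
  is_metric d -> dcompact d -> borel_of_d d ->
  dcontinuous d T -> (forall y, exists x, T x = y) -> ~ injective T ->
  dcontinuous_real d f ->
  T_invariant mu T -> ergodic mu T -> (0 < h_mu mu T)%E ->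
  {ae mu, forall x, (P_mu mu T f <= lim_Ps d T f x)%E}.
Proof.
by move=> md cd bd cT _ _ cf invT ergT _; exact: ae_lim_Ps_ge.
Qed.
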